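(* Let $n\ge 2$, $0\le \alpha<1$, $\mu\ge 0$ and let $p$ satisfy $$1<p\le p_G'(n,\alpha,\mu):= 1+\frac{2}{(1-\alpha)(n-1)+\mu+\alpha}\quad\text{or}\quad 1<p<p_0(n,\alpha,\mu):= 1+\frac{1}{n(1-\alpha)+\mu}.$$ Assume that $u_0\in C^2(\mathbb{R}^n)$ and $u_1\in C^1(\mathbb{R}^n)$ are nontrivial and satisfy $u_1(x)\ge u_0(x)\ge 0$ and $\operatorname{supp}u_0,\ \operatorname{supp}u_1\subset\{|x|\le R\}$ with $R>0$. Suppose that the Cauchy problem $$u_{tt}-\frac{1}{t^{2\alpha}}\Delta u+\frac{\mu}{t}u_t=|u_t|^p,\quad t>1,\ x\in\mathbb{R}^n,\qquad u(1,x)=\varepsilon u_0(x),\quad u_t(1,x)=\varepsilon u_1(x),\quad x\in\mathbb{R}^n,$$ has a classical solution $u\in C^2([1,T)\times\mathbb{R}^n)$. Then $T<\infty$, and there exists a constant $\varepsilon_0>0$ depending on $p,\alpha,\mu,R,u_0,u_1$ such that the lifespan $T_\varepsilon$ has to satisfy $$T_\varepsilon\le C\varepsilon^{\frac{-(p-1)}{1-\{(1-\alpha)(n-1)+\mu+\alpha\}(p-1)/2}}\quad\text{if } p<p_G'(n,\alpha,\mu),$$ $$T_\varepsilon\le \exp\left(C\varepsilon^{-(p-1)}\right)\quad\text{if } p=p_G'(n,\alpha,\mu),$$ $$T_\varepsilon\le C\varepsilon^{\frac{-(p-1)}{1-(p-1)\{n(1-\alpha)+\mu\}}}\quad\text{if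 } p<p_0(n,\alpha,\mu)$$ for $0<\varepsilon\le\varepsilon_0$, where $C>0$ is a constant independent of $\varepsilon$.
   Context: Here $\Delta=\sum_{j=1}^n\partial^2/\partial x_j^2$ and $\varepsilon>0$ is a small parameter. The lifespan $T_\varepsilon$ is the supremum of all $T$ such that the Cauchy problem has a solution for $x\in\mathbb{R}^n$ and $1\le t<T$. *)

(* Defs.v *)
From HB Require Import structures.
From mathcomp Require Import all_boot all_order all_algebra.
From mathcomp Require Import all_classical all_reals all_analysis.

Set Implicit Arguments.
Unset Strict Implicit.
Unset Printing Implicit Defensive.

Import Order.TTheory GRing.Theory Num.Theory.
Import numFieldNormedType.Exports.

Local Open Scope classical_set_scope.
Local Open Scope ring_scope.

(* Directional derivatives relative to a domain [D]: same difference quotient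
   as [derivable] and [derive] of derive.v, but only the increments that stay
   in [D] are considered.  On [1, T) x R^n this gives the one-sided time
   derivative at t = 1; at interior points, and for [D = setT], it is the usual
   derivative (see [derive_within_interior]).  Only the values of [f] on [D]
   matter, when the derivative is taken at a point of [D]. *)
Section DeriveWithin.
Context {R : realType} {V : normedModType R}.
Implicit Types (D : set V) (f : V -> R) (a v : V).

Definition increments D a v : set_system R :=
  within [set h : R | D (h *: v + a)] (0 : R)^'.

Definition derivable_within D f a v : Prop :=
  cvg ((fun h : R => h^-1 *: (f (h *: v + a) - f a)) @ increments D a v).

Definition derive_within D f a v : R :=
  lim ((fun h : R => h^-1 *: (f (h *: v + a) - f a)) @ increments D a v).

Lemma increments_interior D a v : nbhs a D -> increments D a v = (0 : R)^'.
Proof.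
move=> aD.
have hD : \forall h \near (0 : R)^', D (h *: v + a).
  apply: cvg_within.
  have : h *: v + a @[h --> (0 : R)] --> (0 : R) *: v + a.
    by apply: cvgD; [exact: cvgZr_tmp cvg_id|exact: cvg_cst].
  by rewrite scale0r add0r; apply.
apply/seteqP; split => A; last exact: cvg_within.
by move=> HA; apply: filterS2 hD HA => h Dh /(_ Dh).
Qed.

Lemma derive_within_interior D f a v :
  nbhs a D -> derive_within D f a v = 'D_v f a.
Proof. by move=> /increments_interior aD; rewrite /derive_within aD. Qed.

Lemma derivable_within_interior D f a v :
  nbhs a D -> derivable_within D f a v = derivable f a v.
Proof. by move=> /increments_interior aD; rewrite /derivable_within aD. Qed.

(* [f] is of class C^k on [D]: all iterated partial derivatives of order at most
   [k] along the directions of [B] (in any order) exist and are continuous on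
   [D]. *)
Fixpoint Ck_on (B : set V) (k : nat) D f : Prop :=
  {within D, continuous f} /\
  (if k is k'.+1 then
     forall v, B v ->
       (forall a, D a -> derivable_within D f a v) /\
       Ck_on B k' D (derive_within D f ^~ v)
   else True).

End DeriveWithin.

Section Cauchy.
Context {R : realType} {n : nat}.

(* The norm of ['rV[R]_n] in the library is the sup norm; the topology is the
   same. *)
Definition enorm (x : 'rV[R]_n) : R := Num.sqrt (\sum_(j < n) x ord0 j ^+ 2).

Definition supp (f : 'rV[R]_n -> R) : set 'rV[R]_n :=
  closure [set x | f x != 0].

Definition evec (j : 'I_n) : 'rV[R]_n := delta_mx ord0 j.

Definition Ck_space (k : nat) (f : 'rV[R]_n -> R) : Prop :=
  Ck_on (range evec) k setT f.

Definition spacetime : normedModType R := (R * 'rV[R]_n)%type.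

Definition dir_t : spacetime := (1, 0).
Definition dir_x (j : 'I_n) : spacetime := (0, evec j).

(* [1, T) x R^n, where T may be infinite *)
Definition slab (T : \bar R) : set spacetime :=
  [set z | 1 <= z.1 /\ (z.1%:E < T)%E].

Definition Ck_slab (k : nat) (T : \bar R) (u : spacetime -> R) : Prop :=
  Ck_on (dir_t |` range dir_x) k (slab T) u.

Definition pdt (T : \bar R) (u : spacetime -> R) : spacetime -> R :=
  derive_within (slab T) u ^~ dir_t.
Definition pdx (T : \bar R) (j : 'I_n) (u : spacetime -> R) : spacetime -> R :=
  derive_within (slab T) u ^~ (dir_x j).
Definition laplacian (T : \bar R) (u : spacetime -> R) (z : spacetime) : R :=
  \sum_(j < n) pdx T j (pdx T j u) z.

Definition classical_solution (alpha mu p eps : R) (u0 u1 : 'rV[R]_n -> R)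
    (T : \bar R) (u : spacetime -> R) : Prop :=
  [/\ Ck_slab 2 T u,
      forall (t : R) (x : 'rV[R]_n), 1 < t -> (t%:E < T)%E ->
        pdt T (pdt T u) (t, x)
        - (t `^ (2 * alpha))^-1 * laplacian T u (t, x)
        + mu / t * pdt T u (t, x)
        = `| pdt T u (t, x) | `^ p,
      forall x : 'rV[R]_n, u (1, x) = eps * u0 x &
      forall x : 'rV[R]_n, pdt T u (1, x) = eps * u1 x].

(* If no solution exists on any [1, T) with T > 1, this is the supremum of the
   empty set, that is -oo. *)
Definition lifespan (alpha mu p eps : R) (u0 u1 : 'rV[R]_n -> R) : \bar R :=
  ereal_sup [set T : \bar R | (1 < T)%E /\
    exists u : spacetime -> R, classical_solution alpha mu p eps u0 u1 T u].

End Cauchy.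

Definition pG' (R : realType) (n : nat) (alpha mu : R) : R :=
  1 + 2 / ((1 - alpha) * (n%:R - 1) + mu + alpha).

Definition p0 (R : realType) (n : nat) (alpha mu : R) : R :=
  1 + 1 / (n%:R * (1 - alpha) + mu).

(* Main.v *)
Require Import Defs.
From mathcomp Require Import all_boot all_order all_algebra.
From mathcomp Require Import all_classical all_reals all_analysis.
From mathcomp Require Import ring lra.
Import Order.TTheory GRing.Theory Num.Theory.
Import numFieldNormedType.Exports.
Local Open Scope classical_set_scope.
Local Open Scope ring_scope.

Set Implicit Arguments.
Unset Strict Implicit.
Unset Printing Implicit Defensive.

(** The classical argument of Glassey type turns the wave equation into an
    ordinary differential inequality for a spatial integral of the solution.

    Fix a weight h(x) = exp(k x_1), with k = 0 or k = 1, and put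
    F(t) = int u h dx, V(t) = F'(t) = int u_t h dx and G(t) = int |u_t|^p h dx.
    Since Delta h = k^2 h, integration by parts gives
      V' + (mu/t) V - k^2 t^(-2 alpha) F = G.
    The solution lives in the ball of radius
    A(t) + r, A(t) = (t^(1-alpha) - 1)/(1-alpha) ([finite_speed]), so Hoelder's
    inequality bounds G from below by V^p W^(1-p), where W is the integral of h
    over that ball ([rV_int_holder]).  Hence V is driven by a power of itself.

    For k = 0, W = O(t^(n(1-alpha))), and Q = t^mu V satisfies
    Q' >= c t^(-g) Q^p with g = (p-1)(n(1-alpha) + mu)
    ([damped_system_blowup]).  For k = 1, W = O(exp(A) t^((1-alpha)(n-1)/2)),
    because exp(x_1) concentrates the mass of the ball near the pole
    x_1 = A(t) + r, at a distance of order one in x_1 and of order sqrt(A(t) + r)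
    in the n-1 other directions ([exp_ball_volume_le]).  The solutions of the
    linear equation behave as t^((alpha-mu)/2) exp(A) for F; a weight that decays as
    t^((alpha+mu)/2) exp(-A) and is a subsolution of the adjoint
    equation on all of [1, oo) gives a combination Q of V and F with
    Q' >= c t^(-g) Q^p, g = (p-1)((1-alpha)(n-1) + mu + alpha)/2
    ([wave_system_blowup]); u_1 >= u_0 enters there, to keep t^(-alpha) F below
    a multiple of V ([wave_system_slope]).

    Such an inequality bounds the integral of t^(-g) over the existence interval
    by a multiple of Q(1)^(1-p), that is of eps^(1-p) ([blowup_inequality]).  The
    conditions on p say exactly that g <= 1, or g < 1, and solving for the endpoint
    of the interval gives the three bounds.

    The integral over R^n is the limit of Riemann sums over finer and finer grids,
    taken along an ultrafilter of integers, so that it is defined, linear and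
    monotone on all bounded functions of bounded support, continuous or not.  It
    annihilates the partial derivatives of C^1 functions of bounded support
    ([rV_int_partial0]), it is positive on nontrivial nonnegative continuous
    functions ([rV_int_gt0]), and it commutes with time derivatives
    ([rV_int_is_derive]).  Its values are estimated from above by comparison with
    products of one-dimensional profiles ([rV_int_decay]).  Finite speed of
    propagation itself is an energy estimate made with this integral. *)

(** * Riemann sums on a cubic grid *)

Section RiemannSums.
Context {R : realType} {n : nat}.
Implicit Types (f g : 'rV[R]_n -> R) (x : 'rV[R]_n).

Lemma coord_le_norm x i : `|x ord0 i| <= `|x|.
Proof.
rewrite -[`|x|]/(mx_norm x) mx_normrE.
exact: (le_bigmax _ (fun ij : 'I_1 * 'I_n => `|x ij.1 ij.2|) (ord0, i)).
Qed.

Lemma norm_le_coord x (M : R) : 0 <= M ->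
  (forall i, `|x ord0 i| <= M) -> `|x| <= M.
Proof.
by move=> M0 xM; rewrite -[`|x|]/(mx_norm x) mx_normrE; apply/bigmax_leP; split=> // -[i j] _ /=;
  rewrite (ord1 i).
Qed.

Definition mesh (N : nat) : R := N.+1%:R^-1.

(** [gsize N] nodes per axis, of step [mesh N], cover the interval
    [-(N+1), N+1]: the window grows while the step shrinks, so a single sequence
    of sums serves all bounded supports. *)
Definition gsize (N : nat) : nat := (N.+1 ^ 2).*2.+1.

Definition node (N k : nat) : R := (k%:R - (N.+1 ^ 2)%:R) * mesh N.

Definition gpoint (N : nat) (k : {ffun 'I_n -> 'I_(gsize N)}) : 'rV[R]_n :=
  \row_i node N (k i).

Definition rsum (N : nat) f : R :=
  mesh N ^+ n * \sum_(k : {ffun 'I_n -> 'I_(gsize N)}) f (gpoint k).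

Lemma mesh_gt0 N : 0 < mesh N. Proof. by rewrite invr_gt0. Qed.

Lemma mesh_le1 N : mesh N <= 1.
Proof. by rewrite invf_le1// ler1n. Qed.

Lemma nodeS N k : node N k.+1 = node N k + mesh N.
Proof. by rewrite /node -natr1; ring. Qed.

Lemma node0 N : node N 0 = - N.+1%:R.
Proof.
by rewrite /node sub0r natrX expr2 mulNr mulfK// pnatr_eq0.
Qed.

Lemma node_last N : node N (gsize N).-1 = N.+1%:R.
Proof.
by rewrite /node /gsize -pred_Sn -addnn natrD addrK natrX expr2 mulfK// pnatr_eq0.
Qed.

Lemma rsumD N f g : rsum N (f \+ g) = rsum N f + rsum N g.
Proof. by rewrite /rsum big_split mulrDr. Qed.

Lemma rsumZ N (c : R) f : rsum N (fun x => c * f x) = c * rsum N f.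
Proof. by rewrite /rsum -mulr_sumr mulrCA. Qed.

Lemma rsum_le N f g : (forall x, f x <= g x) -> rsum N f <= rsum N g.
Proof.
move=> fg; apply: ler_wpM2l; first by rewrite exprn_ge0// ltW// mesh_gt0.
exact: ler_sum.
Qed.

Lemma rsum_prod N (g : 'I_n -> R -> R) :
  rsum N (fun x => \prod_i g i (x ord0 i)) =
  \prod_i \sum_(k < gsize N) mesh N * g i (node N k).
Proof.
under eq_bigr do rewrite -mulr_sumr.
rewrite big_split/= prodr_const cardT size_enum_ord bigA_distr_bigA/=.
congr (_ * _); apply: eq_bigr => k _; apply: eq_bigr => i _.
by rewrite mxE.
Qed.

(** The translation by one step along [j], made a bijection of the grid by
    wrapping around the window; the nodes affected by the wrapping lie outside
    the support of the functions it is applied to. *)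
Definition cyc (N : nat) (j : 'I_n) (k : {ffun 'I_n -> 'I_(gsize N)}) :
  {ffun 'I_n -> 'I_(gsize N)} := [ffun i => if i == j then ordS (k i) else k i].

Lemma cyc_inj N j : injective (@cyc N j).
Proof.
move=> k l /ffunP kl; apply/ffunP => i; have := kl i; rewrite !ffunE.
by case: eqP => // _ /(bij_inj (@ordS_bij _)).
Qed.

Lemma rsum_shift N (j : 'I_n) f (M : R) : M < N.+1%:R ->
  (forall x, M < `|x| -> f x = 0) ->
  rsum N (fun x => f (mesh N *: evec j + x)) = rsum N f.
Proof.
move=> MN f0; rewrite /rsum; congr (_ * _).
rewrite [RHS](reindex_inj (@cyc_inj N j))/=; apply: eq_bigr => k _.
have outside x : N.+1%:R <= `|x ord0 j| -> f x = 0.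
  by move=> h; apply: f0; rewrite (lt_le_trans MN)// (le_trans h)// coord_le_norm.
have [kj|kj] := eqVneq (k j : nat) (gsize N).-1.
  rewrite outside; last first.
    rewrite !mxE !eqxx/= kj node_last mulr1 ger0_norm ?addr_ge0//; last first.
      exact: ltW (mesh_gt0 _).
    by rewrite lerDr ltW// mesh_gt0.
  rewrite outside// !mxE ffunE eqxx/= kj prednK// modnn node0 normrN.
  by rewrite normr_nat.
have ltk : ((k j).+1 < gsize N)%N.
  by move: (ltn_ord (k j)) kj; rewrite {1}/gsize ltnS leq_eqVlt => /orP[->|].
congr f; apply/rowP => i; rewrite !mxE ffunE eqxx/=.
have [->|_] := eqVneq i j; last by rewrite mulr0 add0r.
by rewrite mulr1 addrC -nodeS; congr (node N _); rewrite /= modn_small.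
Qed.

Lemma telescope_node N (F : R -> R) :
  \sum_(k < gsize N) (F (node N k.+1) - F (node N k)) =
  F (node N (gsize N)) - F (node N 0).
Proof. by rewrite -(big_mkord xpredT (fun k => F (node N k.+1) - F (node N k))) telescope_sumr. Qed.

(** [(1 + |y|)^-2] is the derivative of the bounded function [y / (1 + |y|)]; this is
    the discrete form, which makes grid sums of it telescope. *)
Lemma decay_increment (y h : R) : 0 <= h <= 1 ->
  h * (1 + `|y|) ^- 2 <= 4 * ((y + h) / (1 + `|y + h|) - y / (1 + `|y|)).
Proof.
move=> /andP[h0 h1].
have [y0|y0] := leP 0 y.
  rewrite !ger0_norm ?addr_ge0//.
  have -> : (y + h) / (1 + (y + h)) - y / (1 + y) = h / ((1 + y) * (1 + (y + h))).
    by field; apply/andP; split; apply: lt0r_neq0; lra.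
  rewrite mulrCA ler_wpM2l// -invf_div.
  rewrite lef_pV2 ?posrE ?divr_gt0 ?mulr_gt0 ?exprn_gt0; try lra.
  nra.
have [yh|yh] := leP (y + h) 0.
  rewrite (ltr0_norm y0) (ler0_norm yh).
  have -> : (y + h) / (1 + - (y + h)) - y / (1 + - y) = h / ((1 - y) * (1 - (y + h))).
    by field; apply/andP; split; apply: lt0r_neq0; lra.
  rewrite mulrCA ler_wpM2l// -invf_div.
  rewrite lef_pV2 ?posrE ?divr_gt0 ?mulr_gt0 ?exprn_gt0; try lra.
  nra.
rewrite (ltr0_norm y0) (gtr0_norm yh).
have h2 : h * (1 - y) ^- 2 <= h.
  by rewrite ler_piMr// invf_le1 ?exprn_gt0//; nra.
apply: (le_trans h2).
have h3 : h / 2 <= (y + h) / (1 + (y + h)) - y / (1 - y).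
  have -> : h / 2 = (y + h) / 2 + (- y) / 2 by field.
  rewrite -mulNr; apply: lerD; rewrite ler_pM2l ?lef_pV2 ?posrE//; lra.
lra.
Qed.

(** The bound does not depend on the centre [c]: no lattice point count is needed
    to estimate sums over shifted or scaled profiles. *)
Lemma node_sum_decay N (c s : R) : mesh N <= s ->
  \sum_(k < gsize N) mesh N * (1 + `|node N k - c| / s) ^- 2 <= 8 * s.
Proof.
move=> hs; have h0 := mesh_gt0 N; have s0 : 0 < s by exact: lt_le_trans hs.
pose F (y : R) := ((y - c) / s) / (1 + `|(y - c) / s|).
have F1 y : `|F y| <= 1.
  rewrite /F normrM normfV (@gtr0_norm _ (1 + _)) ?ltr_pwDl//.
  by rewrite ler_pdivrMr ?ltr_pwDl// mul1r lerDr.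
apply: (@le_trans _ _ (\sum_(k < gsize N)
    4 * s * (F (node N k.+1) - F (node N k)))).
  apply: ler_sum => k _.
  have hb : 0 <= mesh N / s <= 1.
    by rewrite divr_ge0 ?(ltW h0) ?(ltW s0)//= ler_pdivrMr// mul1r.
  have := decay_increment ((node N k - c) / s) hb.
  rewrite -mulrDl -[node N k - c + _]addrAC -nodeS.
  rewrite normrM normfV (gtr0_norm s0) -/(F _) => H.
  have -> : mesh N = s * (mesh N / s) by field; lra.
  rewrite -[leLHS]mulrA -(mulrC s) -[leRHS]mulrA ler_pM2l//.
  by rewrite {2}/F normrM normfV (gtr0_norm s0).
rewrite -mulr_sumr telescope_node.
have := F1 (node N (gsize N)); have := F1 (node N 0).
rewrite !ler_norml => /andP[? ?] /andP[? ?].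
nra.
Qed.

(** The upper bound used for every integral below: a product of one-dimensional
    profiles of widths [s i] has an integral of order [\prod_i s i]. *)
Lemma rsum_decay N f (A : R) (c s : 'I_n -> R) : 0 <= A ->
  (forall i, mesh N <= s i) ->
  (forall x, f x <= A * \prod_i (1 + `|x ord0 i - c i| / s i) ^- 2) ->
  rsum N f <= A * \prod_i (8 * s i).
Proof.
move=> A0 hs hf; apply: (le_trans (rsum_le N hf)).
rewrite rsumZ (rsum_prod _ (fun i y => (1 + `|y - c i| / s i) ^- 2)).
apply: ler_wpM2l => //; apply: ler_prod => i _.
rewrite node_sum_decay// andbT sumr_ge0// => k _.
by rewrite mulr_ge0 ?(ltW (mesh_gt0 _))// invr_ge0 exprn_ge0// addr_ge0//
  divr_ge0// (le_trans (ltW (mesh_gt0 N)) (hs i)).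
Qed.

(** Counts grid nodes near [c] from below, by telescoping the truncation of the
    identity to [c - d/2, c + d/2], which has total variation [d]. *)
Lemma node_sum_near N (c d : R) : 0 < d -> mesh N <= d / 2 ->
  `|c| + d <= N.+1%:R ->
  d <= \sum_(k < gsize N) mesh N * (`|node N k - c| <= d)%R%:R.
Proof.
move=> d0 hd cN; have h0 := mesh_gt0 N.
pose F (y : R) := Num.max (c - d / 2) (Num.min (c + d / 2) y).
have cc : - `|c| <= c <= `|c| by rewrite -ler_norml.
have dE : d = F (node N (gsize N)) - F (node N 0).
  have -> : node N (gsize N) = N.+1%:R + mesh N.
    by rewrite -node_last -nodeS.
  rewrite node0 /F.
  rewrite (_ : Num.min _ (N.+1%:R + _) = c + d / 2); last by apply/min_idPl; lra.
  rewrite (_ : Num.min _ (- _) = - N.+1%:R); last by apply/min_idPr; lra.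
  rewrite (_ : Num.max _ (c + _) = c + d / 2); last by apply/max_idPr; lra.
  rewrite (_ : Num.max _ (- _) = c - d / 2); last by apply/max_idPl; lra.
  by field.
rewrite [leLHS]dE -telescope_node; apply: ler_sum => k _.
rewrite nodeS; move: (node N k) => y.
have FE z : (z <= c - d / 2 /\ F z = c - d / 2) \/
    (c + d / 2 <= z /\ F z = c + d / 2) \/
    (c - d / 2 <= z <= c + d / 2 /\ F z = z).
  rewrite /F; case: (leP (c + d / 2) z) => h1.
    by right; left; split=> //; apply/max_idPr; lra.
  case: (leP (c - d / 2) z) => h2; [right; right|left]; split=> //; lra.
move: (FE y) (FE (y + mesh N)); case: (leP `|y - c|) => /= hyc;
    rewrite ?mulr1n ?mulr1 ?mulr0n ?mulr0.
  by case=> [[? ->]|[[? ->]|[? ->]]]; case=> [[? ->]|[[? ->]|[? ->]]]; lra.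
move: hyc; rewrite ltNge ler_norml negb_and -!ltNge => /orP[] ?;
  by case=> [[? ->]|[[? ->]|[? ->]]]; case=> [[? ->]|[[? ->]|[? ->]]]; lra.
Qed.

End RiemannSums.
(** * Elementary calculus on lines and compact sets *)

Section Calculus.
Context {R : realType}.

Lemma is_derive_line (V : normedModType R) (f : V -> R) (x v : V) (s d : R) :
  is_derive (s *: v + x) v f d <-> is_derive s 1 (fun r => f (r *: v + x)) d.
Proof.
have E : (fun h : R => h^-1 *: (f (h *: v + (s *: v + x)) - f (s *: v + x))) =
    (fun h : R => h^-1 *: (f ((h *: (1 : R) + s) *: v + x) - f (s *: v + x))).
  by apply/funext => h; rewrite scalerDl addrA [h *: 1]mulr1.
split=> -[D1 D2]; apply: DeriveDef; rewrite /derivable /derive.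
- by rewrite -E.
- by rewrite -E.
- by rewrite E.
- by rewrite E.
Qed.

Lemma MVT_around (f df : R -> R) (t h : R) :
  (forall s, `|s - t| <= `|h| -> is_derive s 1 f (df s)) ->
  exists2 s, `|s - t| <= `|h| & f (h + t) - f t = df s * h.
Proof.
move=> fdf.
have cont a b : (forall s, s \in `[a, b] -> `|s - t| <= `|h|) ->
    {within `[a, b], continuous f}.
  move=> ab; apply: derivable_within_continuous => s sab.
  by have [] := fdf s (ab _ sab).
have [h0|h0] := leP 0 h.
  have I s : s \in `[t, h + t] -> `|s - t| <= `|h|.
    by rewrite in_itv/= => /andP[? ?]; rewrite !ger0_norm; lra.
  have th : t <= h + t by lra.
  have [||s /I ss E] := @MVT_segment _ f df t (h + t) th.
  - by move=> s /subset_itv_oo_cc/I/fdf.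
  - exact: cont I.
  by exists s => //; rewrite E addrK.
have I s : s \in `[h + t, t] -> `|s - t| <= `|h|.
  by rewrite in_itv/= => /andP[? ?]; rewrite !ler0_norm; lra.
have th : h + t <= t by lra.
have [||s /I ss E] := @MVT_segment _ f df (h + t) t th.
- by move=> s /subset_itv_oo_cc/I/fdf.
- exact: cont I.
by exists s => //; rewrite -opprB E; ring.
Qed.

Lemma is_derive_near0 (f : R -> R) (t d : R) :
  (\forall s \near t, f s = 0) -> is_derive t 1 f d -> d = 0.
Proof.
move=> f0 fd.
have E : {near t, f =1 cst 0} by exact: f0.
have [_ <-] := near_eq_is_derive E fd.
by rewrite derive_cst.
Qed.

(** Tube lemma: the only source of uniformity in the limits below. *)
Lemma near_uniformly_on_compact (I T : topologicalType) (K : set T)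
    (g : I * T -> R) (t : I) (e : R) : compact K -> 0 < e ->
  (forall x, K x -> {for (t, x), continuous g}) ->
  \forall s \near t, forall x, K x -> `|g (s, x) - g (t, x)| < e.
Proof.
move=> /compact_near_coveringP cK e0 cg.
apply: (cK I (nbhs t) (fun s x => `|g (s, x) - g (t, x)| < e)) => x Kx.
have e2 : 0 < e / 2 by rewrite divr_gt0.
have /cvgrPdist_lt/(_ _ e2) [[A B]/= [At Bx] AB] := cg x Kx.
exists (B, A) => //= -[y s]/= [By As].
have h1 : `|g (t, x) - g (s, y)| < e / 2 by exact: (AB (s, y)).
have h2 : `|g (t, x) - g (t, y)| < e / 2.
  by apply: (AB (t, y)); split => //=; exact: nbhs_singleton.
have -> : g (s, y) - g (t, y) = (g (t, x) - g (t, y)) - (g (t, x) - g (s, y)).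
  by ring.
rewrite (le_lt_trans (ler_normB _ _))//; lra.
Qed.

Lemma compact_norm_le n (M : R) : compact [set x : 'rV[R]_n | `|x| <= M].
Proof.
have [M0|M0] := leP 0 M; last first.
  rewrite (_ : mkset _ = set0); first exact: compact0.
  by apply/seteqP; split=> x //= xM; have := normr_ge0 x; lra.
rewrite (_ : mkset _ = [set v : 'rV[R]_n | forall i, `[- M, M]%classic (v ord0 i)]).
  apply: (@rV_compact R n (fun=> `[- M, M]%classic)) => i.
  exact: segment_compact.
apply/seteqP; split=> x /= xM.
  by move=> i; rewrite /= in_itv/= -ler_norml (le_trans (coord_le_norm _ _)).
by apply: norm_le_coord => // i; have := xM i; rewrite /= in_itv/= -ler_norml.
Qed.

End Calculus.

(** * The integral over the space, as an ultrafilter limit *)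

Section RVInt.
Context {R : realType} {n : nat}.
Implicit Types (f g : 'rV[R]_n -> R) (x : 'rV[R]_n).

(** Along an ultrafilter every bounded sequence of sums converges, so integrability is
    reduced to boundedness and linearity is that of limits. *)
Lemma ex_ultra_nat : exists U : set_system nat, UltraFilter U /\ \oo `<=` U.
Proof. exact: ultraFilterLemma. Qed.

Definition ultra_nat : set_system nat := projT1 (cid ex_ultra_nat).

#[global] Instance ultra_nat_ultra : UltraFilter ultra_nat.
Proof. by rewrite /ultra_nat; case: cid => U []. Qed.

#[global] Instance ultra_nat_proper : ProperFilter ultra_nat.
Proof. exact: ultra_proper. Qed.

Lemma ultra_nat_oo : \oo `<=` ultra_nat.
Proof. by rewrite /ultra_nat; case: cid => U []. Qed.

Definition rV_int f : R := lim (rsum N f @[N --> ultra_nat]).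

Definition bsupp f := exists M : R, forall x, `|f x| <= M /\ (M < `|x| -> f x = 0).

Lemma rsum_sup N f (M s : R) : 1 <= M -> 0 <= s ->
  (forall x, M < `|x| -> f x = 0) -> (forall x, `|x| <= M -> `|f x| <= s) ->
  `|rsum N f| <= s * (32 * M) ^+ n.
Proof.
move=> M1 s0 f0 fs.
have M0 : 0 < M by lra.
have key g : (forall x, M < `|x| -> g x = 0) ->
    (forall x, `|x| <= M -> g x <= s) -> rsum N g <= s * (32 * M) ^+ n.
  move=> g0 gs.
  (* The factor 4 per axis bounds (1 + y)^2 for 0 <= y <= 1. *)
  have := @rsum_decay R n N g (s * 4 ^+ n) (fun=> 0) (fun=> M).
  rewrite prodr_const cardT size_enum_ord.
  rewrite -mulrA -exprMn_comm; last exact: mulrC.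
  rewrite (_ : 4 * (8 * M) = 32 * M); last by ring.
  apply.
  - by rewrite mulr_ge0.
  - by move=> i; rewrite (le_trans (mesh_le1 _)).
  move=> x; have [xM|xM] := leP `|x| M; last first.
    rewrite g0// mulr_ge0// ?mulr_ge0// prodr_ge0// => i _.
    by rewrite invr_ge0 exprn_ge0// addr_ge0// divr_ge0// ltW.
  rewrite (le_trans (gs x xM))// -mulrA ler_peMr//.
  rewrite (_ : 4 ^+ n = \prod_(i < n) (4 : R)); last first.
    by rewrite prodr_const cardT size_enum_ord.
  rewrite -big_split/=; elim/big_ind: _ => //.
    by move=> a b a1 b1; rewrite (le_trans a1)// ler_peMr//; lra.
  move=> i _; rewrite subr0 ler_pdivlMr ?mul1r; last first.
    by rewrite exprn_gt0// ltr_pwDl// divr_ge0// ltW.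
  have : `|x ord0 i| / M <= 1.
    by rewrite ler_pdivrMr// mul1r (le_trans (coord_le_norm _ _)).
  have : 0 <= `|x ord0 i| / M by rewrite divr_ge0// ltW.
  nra.
rewrite ler_norml; apply/andP; split.
  rewrite lerNl -mulN1r -rsumZ; apply: key => x xM.
    by rewrite f0// mulr0.
  by rewrite mulN1r lerNl; have := fs x xM; rewrite ler_norml => /andP[].
by apply: key => // x xM; have := fs x xM; rewrite ler_norml => /andP[].
Qed.

Lemma rV_int_cvg f : bsupp f -> rsum N f @[N --> ultra_nat] --> rV_int f.
Proof.
move=> [M fM]; pose M' := Num.max 1 M.
have M'1 : 1 <= M' by rewrite le_max lexx.
have MM' : M <= M' by rewrite le_max lexx orbT.
pose B := M' * (32 * M') ^+ n.
have bd N : rsum N f \in `[- B, B].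
  rewrite in_itv/= -ler_norml; apply: rsum_sup => //.
  - by lra.
  - by move=> x xM; apply (fM x); lra.
  - by move=> x xM; apply: le_trans MM'; have [] := fM x.
have cB : compact `[- B, B]%classic by exact: segment_compact.
move: cB; rewrite compact_ultra => /(_ (rsum N f @[N --> ultra_nat])).
case.
- apply: Build_UltraFilter => G GG sub; apply/seteqP; split; last exact: sub.
  move=> A GA.
  have [//|nA] := in_ultra_setVsetC [set N | A (rsum N f)] ultra_nat_ultra.
  have /filter_ex [y []] : G (A `&` ~` A) by apply: filterI => //; exact: sub.
  by [].
- by apply: (@filterS _ ultra_nat _ setT) => [N _|]; [exact: bd|exact: filterT].
move=> l [_ /= cl].
by apply/cvg_ex; exists l.
Qed.

Lemma rV_int_near f (c : R) : bsupp f ->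
  (\forall N \near \oo, rsum N f <= c) -> rV_int f <= c.
Proof.
move=> /rV_int_cvg cf H; apply: (cvgr_to_le cf).
exact: ultra_nat_oo.
Qed.

Lemma bsuppD f g : bsupp f -> bsupp g -> bsupp (f \+ g).
Proof.
move=> [M fM] [M' gM]; exists (M + M') => x.
have [fx fx0] := fM x; have [gx gx0] := gM x.
have := normr_ge0 (f x); have := normr_ge0 (g x) => ? ?.
split=> [|xM]; first by rewrite (le_trans (ler_normD _ _))// lerD.
by rewrite /= fx0 ?gx0 ?addr0//; lra.
Qed.

Lemma bsuppZ (c : R) f : bsupp f -> bsupp (fun x => c * f x).
Proof.
move=> [M fM]; exists (Num.max M (`|c| * M)) => x; have [fx fx0] := fM x.
split; first by rewrite le_max normrM ler_wpM2l ?orbT.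
by rewrite gt_max => /andP[/fx0 -> _]; rewrite mulr0.
Qed.

Lemma rV_intD f g : bsupp f -> bsupp g -> rV_int (f \+ g) = rV_int f + rV_int g.
Proof.
move=> bf bg; apply: cvg_lim => //.
under eq_cvg do rewrite rsumD.
by apply: cvgD; exact: rV_int_cvg.
Qed.

Lemma rV_intZ (c : R) f : bsupp f -> rV_int (fun x => c * f x) = c * rV_int f.
Proof.
move=> bf; apply: cvg_lim => //.
under eq_cvg do rewrite rsumZ.
by apply: cvgM; [exact: cvg_cst|exact: rV_int_cvg].
Qed.

Lemma bsuppB f g : bsupp f -> bsupp g -> bsupp (fun x => f x - g x).
Proof.
move=> bf /(bsuppZ (-1)) bg; have := bsuppD bf bg.
by congr bsupp; apply/funext => x /=; rewrite mulN1r.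
Qed.

Lemma rV_intB f g : bsupp f -> bsupp g ->
  rV_int (fun x => f x - g x) = rV_int f - rV_int g.
Proof.
move=> bf bg; rewrite -mulN1r -rV_intZ// -rV_intD//; last exact: bsuppZ.
by congr rV_int; apply/funext => x /=; rewrite mulN1r.
Qed.

Lemma bsupp0 : bsupp (fun=> 0).
Proof. by exists 0 => x; rewrite normr0. Qed.

Lemma rV_int0 : rV_int (fun=> 0) = 0.
Proof.
have -> : (fun=> 0) = (fun x : 'rV[R]_n => 0 * 0) :> (_ -> R).
  by apply/funext => x; rewrite mulr0.
by rewrite rV_intZ ?mul0r//; exact: bsupp0.
Qed.

Lemma bsupp_sum (I : finType) (F : I -> 'rV[R]_n -> R) :
  (forall i, bsupp (F i)) -> bsupp (fun x => \sum_i F i x).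
Proof.
move=> bF.
have : bsupp (\big[(fun f g : _ -> R => f \+ g)/(fun=> 0)]_i F i).
  by elim/big_ind : _ => //; [exact: bsupp0|exact: bsuppD].
congr bsupp; apply/funext => x.
by elim/big_rec2 : _ => //= i a b _ <-.
Qed.

Lemma rV_int_sum (I : finType) (F : I -> 'rV[R]_n -> R) :
  (forall i, bsupp (F i)) -> rV_int (fun x => \sum_i F i x) = \sum_i rV_int (F i).
Proof.
move=> bF.
suff [] : bsupp (fun x => \sum_i F i x) /\
  rV_int (fun x => \sum_i F i x) = \sum_i rV_int (F i) by [].
elim: (index_enum I) => [|i s [IH1 IH2]].
  rewrite big_nil (_ : (fun x => _) = fun=> 0).
    by split; [exact: bsupp0|exact: rV_int0].
  by apply/funext => x; rewrite big_nil.
rewrite (_ : (fun x => _) = F i \+ (fun x => \sum_(j <- s) F j x)).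
  by split; [exact: bsuppD|rewrite rV_intD// big_cons IH2].
by apply/funext => x; rewrite big_cons.
Qed.

Lemma rV_int_le f g : bsupp f -> bsupp g -> (forall x, f x <= g x) ->
  rV_int f <= rV_int g.
Proof.
move=> bf bg fg; rewrite -subr_ge0 -rV_intB//.
apply: (cvgr_to_ge (rV_int_cvg (bsuppB bg bf))).
apply: filterE => N; rewrite /rsum mulr_ge0 ?exprn_ge0 ?(ltW (mesh_gt0 _))//.
by rewrite sumr_ge0// => k _; rewrite subr_ge0.
Qed.

Lemma rV_int_ge0 f : bsupp f -> (forall x, 0 <= f x) -> 0 <= rV_int f.
Proof. by move=> bf f0; rewrite -rV_int0; apply: rV_int_le => //; exact: bsupp0. Qed.

Lemma rV_int_sup f (M s : R) : 1 <= M -> 0 <= s -> bsupp f ->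
  (forall x, M < `|x| -> f x = 0) -> (forall x, `|x| <= M -> `|f x| <= s) ->
  `|rV_int f| <= s * (32 * M) ^+ n.
Proof.
move=> M1 s0 bf f0 fs.
have key g : bsupp g -> (forall x, M < `|x| -> g x = 0) ->
    (forall x, `|x| <= M -> `|g x| <= s) -> rV_int g <= s * (32 * M) ^+ n.
  move=> bg g0 gs; apply: rV_int_near => //; apply: nearW => N.
  by apply: le_trans (rsum_sup _ M1 s0 g0 gs); exact: ler_norm.
rewrite ler_norml key// andbT lerNl -mulN1r -rV_intZ//; apply: key => [|x|x].
- exact: bsuppZ.
- by move=> /f0 ->; rewrite mulr0.
- by rewrite mulN1r normrN; exact: fs.
Qed.

(** The widths need not exceed the mesh at first: the mesh tends to zero. *)
Lemma rV_int_decay f (A : R) (c s : 'I_n -> R) : 0 <= A -> bsupp f ->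
  (forall i, 0 < s i) ->
  (forall x, f x <= A * \prod_i (1 + `|x ord0 i - c i| / s i) ^- 2) ->
  rV_int f <= A * \prod_i (8 * s i).
Proof.
move=> A0 bf s0 hf; apply: rV_int_near => //.
have : \forall N \near \oo, forall i, mesh N <= s i :> R.
  apply: filter_forall => i.
  have := near_infty_natSinv_lt (PosNum (s0 i)).
  by apply: filterS => N /ltW.
by apply: filterS => N hN; exact: rsum_decay.
Qed.

Lemma rV_int_gt0 f x0 : bsupp f -> {for x0, continuous f} ->
  (forall x, 0 <= f x) -> 0 < f x0 -> 0 < rV_int f.
Proof.
move=> bf cf f0 fx0.
have e2 : 0 < f x0 / 2 by rewrite divr_gt0.
have /cvgrPdist_lt/(_ _ e2)/nbhs_ballP [d /= d0 H] := cf.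
have d2 : 0 < d / 2 by rewrite divr_gt0.
suff : f x0 / 2 * (d / 2) ^+ n <= rV_int f.
  by apply: lt_le_trans; rewrite mulr_gt0// exprn_gt0.
apply: (cvgr_to_ge (rV_int_cvg bf)); apply: ultra_nat_oo.
have near1 : \forall N \near \oo, mesh N <= d / 2 / 2 :> R.
  have d4 : 0 < d / 2 / 2 by rewrite divr_gt0.
  have := near_infty_natSinv_lt (PosNum d4).
  by apply: filterS => N /ltW.
have near2 : \forall N \near \oo, `|x0| + d / 2 <= N.+1%:R.
  have := nbhs_infty_ger (`|x0| + d / 2).
  by apply: filterS => N h; rewrite (le_trans h)// ler_nat.
apply: filterS2 near1 near2 => N h1 h2.
apply: (@le_trans _ _ (rsum N (fun x => f x0 / 2 *
    \prod_i (`|x ord0 i - x0 ord0 i| <= d / 2)%R%:R))).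
  rewrite rsumZ (rsum_prod N (fun i y => (`|y - x0 ord0 i| <= d / 2)%R%:R)).
  apply: ler_wpM2l; first exact: ltW.
  rewrite (_ : (d / 2) ^+ n = \prod_(i < n) (d / 2)); last first.
    by rewrite prodr_const cardT size_enum_ord.
  apply: ler_prod => i _; rewrite (ltW d2)/=; apply: node_sum_near => //.
  by rewrite (le_trans _ h2)// lerD2r coord_le_norm.
apply: rsum_le => x.
have [near|] := boolP [forall i, `|x ord0 i - x0 ord0 i| <= d / 2]; last first.
  rewrite negb_forall => /existsP[i /negbTE xi].
  by rewrite (bigD1 i)//= xi mul0r mulr0.
have xd : `|x0 - x| < d.
  apply: (@le_lt_trans _ _ (d / 2)); last by lra.
  apply: norm_le_coord; first exact: ltW.
  by move=> i; rewrite !mxE distrC; exact: (forallP near).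
have := H x; rewrite -ball_normE /= => /(_ xd).
rewrite big1 ?mulr1; last by move=> i _; rewrite (forallP near).
by rewrite ltr_norml => /andP[_ ?]; lra.
Qed.

Lemma continuous_bsupp f (M : R) : continuous f ->
  (forall x, M < `|x| -> f x = 0) -> bsupp f.
Proof.
move=> cf f0.
have [B [_ HB]] : bounded_set (f @` [set x | `|x| <= M]).
  apply: compact_bounded; apply: continuous_compact; last exact: compact_norm_le.
  exact: continuous_subspaceT.
exists (Num.max M (Num.max 0 (B + 1))) => x; split; last first.
  by rewrite gt_max => /andP[/f0].
have [xM|xM] := leP `|x| M; last by rewrite f0// normr0 !le_max lexx orbT.
have -> : `|f x| <= Num.max M (Num.max 0 (B + 1)) = true => //.
rewrite !le_max; apply/orP; right; apply/orP; right.
by apply: (HB (B + 1)); [lra|exists x].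
Qed.

End RVInt.
(** * Continuity, derivatives and integration by parts *)

Section RVIntCalculus.
Context {R : realType} {n : nat}.
Implicit Types (f : 'rV[R]_n -> R) (g : R * 'rV[R]_n -> R) (x : 'rV[R]_n).

Lemma slice_continuous (g : R * 'rV[R]_n -> R) (t : R) :
  (forall x, {for (t, x), continuous g}) -> continuous (fun x => g (t, x)).
Proof.
move=> cg x; apply: (@continuous_comp _ _ _ (fun x => (t, x)) g); last exact: cg.
exact: (@cvg_pair _ _ _ (nbhs x) (nbhs t) (nbhs x) _ _ _ (fun=> t) id
  (cvg_cst t) cvg_id).
Qed.

Lemma rV_int_continuous g (t M : R) :
  (\forall s \near t, forall x, {for (s, x), continuous g}) ->
  (\forall s \near t, forall x, M < `|x| -> g (s, x) = 0) ->
  {for t, continuous (fun s => rV_int (fun x => g (s, x)))}.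
Proof.
move=> cg g0; pose M1 := Num.max 1 M.
have M11 : 1 <= M1 by rewrite le_max lexx.
have MM1 x : M1 < `|x| -> M < `|x| by rewrite gt_max => /andP[].
have C0 : 0 < (32 * M1) ^+ n by rewrite exprn_gt0//; lra.
apply/cvgrPdist_lt => e e0.
pose d := e / 2 / (32 * M1) ^+ n.
have d0 : 0 < d by rewrite /d !divr_gt0.
have cgt := nbhs_singleton cg; have g0t := nbhs_singleton g0.
have := @near_uniformly_on_compact R R _ _ g t d (@compact_norm_le R n M1) d0
  (fun x _ => cgt x).
move: cg g0; apply: filterS3 => s cg g0 gd.
have bs : bsupp (fun x => g (s, x)).
  exact: continuous_bsupp (slice_continuous cg) g0.
have bt : bsupp (fun x => g (t, x)).
  exact: continuous_bsupp (slice_continuous cgt) g0t.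
rewrite distrC -rV_intB//; apply: (@le_lt_trans _ _ (d * (32 * M1) ^+ n)).
  apply: rV_int_sup => //; [exact: ltW|exact: bsuppB| |].
    by move=> x xM; rewrite g0 ?g0t ?subrr//; exact: MM1.
  by move=> x xM; apply/ltW/gd.
by rewrite /d divfK ?gt_eqF//; lra.
Qed.

(** Differentiation under the integral sign: by the mean value theorem the difference
    quotients are values of [g'] at nearby times, uniformly close on the
    common bounded support. *)
Lemma rV_int_is_derive g g' (t M : R) :
  (\forall s \near t, forall x, {for (s, x), continuous g}) ->
  (forall x, {for (t, x), continuous g'}) ->
  (\forall s \near t, forall x, is_derive (s : R) 1 (fun s : R => g (s, x)) (g' (s, x))) ->
  (\forall s \near t, forall x, M < `|x| -> g (s, x) = 0) ->
  is_derive t 1 (fun s => rV_int (fun x => g (s, x))) (rV_int (fun x => g' (t, x))).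
Proof.
move=> cg cg' gg' g0; pose M1 := Num.max 1 M.
have M11 : 1 <= M1 by rewrite le_max lexx.
have MM1 x : M1 < `|x| -> M < `|x| by rewrite gt_max => /andP[].
have C0 : 0 < (32 * M1) ^+ n by rewrite exprn_gt0//; lra.
have cgt := nbhs_singleton cg; have g0t := nbhs_singleton g0.
have g'0 x : M < `|x| -> g' (t, x) = 0.
  move=> xM; apply: is_derive_near0 (nbhs_singleton gg' x).
  by move: g0; apply: filterS => s /(_ x xM).
have bt : bsupp (fun x => g (t, x)).
  exact: continuous_bsupp (slice_continuous cgt) g0t.
have b't : bsupp (fun x => g' (t, x)).
  exact: continuous_bsupp (slice_continuous cg') g'0.
suff H : h^-1 *: (rV_int (fun x => g (h *: (1 : R) + t, x)) - rV_int (fun x => g (t, x)))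
    @[h --> (0 : R)^'] --> rV_int (fun x => g' (t, x)).
  apply: DeriveDef; last exact: cvg_lim.
  by apply/cvg_ex; eexists; exact: H.
apply/cvgrPdist_lt => e e0.
pose d := e / 2 / (32 * M1) ^+ n.
have d0 : 0 < d by rewrite /d !divr_gt0.
have unif := @near_uniformly_on_compact R R _ _ g' t d (@compact_norm_le R n M1) d0
  (fun x _ => cg' x).
have /nbhs_ballP[r /= r0 Hr] : \forall s \near t,
    [/\ forall x, {for (s, x), continuous g},
     forall x, is_derive (s : R) 1 (fun s : R => g (s, x)) (g' (s, x)),
     forall x, M < `|x| -> g (s, x) = 0 &
     forall x, `|x| <= M1 -> `|g' (s, x) - g' (t, x)| < d].
  by near=> s; split; near: s.
rewrite near_withinE; apply/nbhs_ballP; exists r => //= h.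
rewrite -ball_normE/= sub0r normrN => hr hn0.
have Hs s : `|s - t| <= `|h| -> ball t r s.
  by rewrite -ball_normE/= distrC => sh; exact: le_lt_trans hr.
have ht : ball t r (h + t) by apply: Hs; rewrite addrK.
rewrite [h *: 1]mulr1.
have [cgh _ g0h _] := Hr _ ht.
have bh : bsupp (fun x => g (h + t, x)).
  exact: continuous_bsupp (slice_continuous cgh) g0h.
rewrite -rV_intB// -[h^-1 *: _]/(h^-1 * _) -rV_intZ; last exact: bsuppB.
rewrite -rV_intB//; last by apply: bsuppZ; exact: bsuppB.
apply: (@le_lt_trans _ _ (d * (32 * M1) ^+ n)); last first.
  by rewrite /d divfK ?gt_eqF//; lra.
apply: rV_int_sup => //.
- exact: ltW.
- by apply: bsuppB => //; apply: bsuppZ; exact: bsuppB.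
- by move=> x /MM1 xM; rewrite g0h// g0t// g'0// subrr mulr0 subrr.
move=> x xM.
have [s sh ->] := @MVT_around R (fun s => g (s, x)) (fun s => g' (s, x)) t h
  (fun s sh => let: And4 _ H _ _ := Hr _ (Hs _ sh) in H x).
rewrite mulrC mulfK// distrC ltW//.
by have [_ _ _] := Hr _ (Hs _ sh); apply.
Unshelve. all: by end_near. Qed.

Lemma norm_evec (j : 'I_n) : `|evec j : 'rV[R]_n| <= 1.
Proof.
apply: norm_le_coord => // i; rewrite mxE eqxx/=.
by case: eqP => _; rewrite ?normr1 ?normr0.
Qed.

Lemma partial_support f (df : 'rV[R]_n -> R) (j : 'I_n) (M : R) :
  (forall x, is_derive x (evec j) f (df x)) ->
  (forall x, M < `|x| -> f x = 0) -> forall x, M < `|x| -> df x = 0.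
Proof.
move=> fdf f0 x xM.
have L : is_derive (0 : R) 1 (fun r : R => f (r *: evec j + x)) (df x).
  apply: (proj1 (@is_derive_line R _ f x (evec j) 0 _)).
  by rewrite scale0r add0r.
apply: is_derive_near0 L.
have : `|r *: evec j + x| @[r --> (0 : R)] --> `|x|.
  rewrite -[in X in _ --> X](add0r x) -(scale0r (evec j)).
  apply: cvg_norm; apply: cvgD; last exact: cvg_cst.
  exact: cvgZr_tmp cvg_id.
by move=> /cvgr_gt/(_ _ xM); apply: filterS => r /f0.
Qed.

(** The grid sum of a difference quotient with step equal to the mesh vanishes exactly, by
    [rsum_shift], and differs from the sum of the derivative by a uniformly small
    amount. *)
Lemma rV_int_partial0 f (df : 'rV[R]_n -> R) (j : 'I_n) (M : R) :
  (forall x, is_derive x (evec j) f (df x)) -> continuous df ->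
  (forall x, M < `|x| -> f x = 0) -> rV_int df = 0.
Proof.
move=> fdf cdf f0; pose M1 := Num.max 1 (M + 1).
have M11 : 1 <= M1 by rewrite le_max lexx.
have MM1 x : M1 < `|x| -> M + 1 < `|x| by rewrite gt_max => /andP[].
have C0 : 0 < (32 * M1) ^+ n by rewrite exprn_gt0//; lra.
have line x (s : R) : is_derive s 1 (fun r : R => f (r *: evec j + x)) (df (s *: evec j + x)).
  exact: (proj1 (@is_derive_line R _ f x (evec j) s _) (fdf _)).
have ne := norm_evec j.
have df0 x : M < `|x| -> df x = 0 by exact: partial_support fdf f0 x.
have bdf : bsupp df by exact: continuous_bsupp df0.
apply/eqP; rewrite -normr_le0; apply/ler_addgt0Pr => e e0; rewrite add0r.
pose d := e / (32 * M1) ^+ n.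
have d0 : 0 < d by rewrite /d !divr_gt0.
pose G (z : R * 'rV[R]_n) := df (z.1 *: evec j + z.2).
have cG z : {for z, continuous G}.
  apply: (@continuous_comp _ _ _ (fun z : R * 'rV[R]_n => z.1 *: evec j + z.2) df);
    last exact: cdf.
  apply: cvgD; last exact: cvg_snd.
  apply: (@cvgZr_tmp _ _ _ _ _ (fun z : R * 'rV[R]_n => z.1)); exact: cvg_fst.
have := @near_uniformly_on_compact R R _ _ G 0 d (@compact_norm_le R n M1) d0
  (fun x _ => cG (0, x)).
move=> /nbhs_ballP[r /= r0 Hr].
have cN : `|rsum N df| @[N --> ultra_nat] --> `|rV_int df|.
  by apply: cvg_norm; exact: rV_int_cvg.
apply: (cvgr_to_le cN); apply: ultra_nat_oo.
have near1 : \forall N \near \oo, mesh N < r :> R.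
  exact: near_infty_natSinv_lt (PosNum r0).
have near2 : \forall N \near \oo, M < N.+1%:R.
  by have := nbhs_infty_gtr M; apply: filterS => N h; rewrite (lt_trans h)// ltr_nat.
apply: filterS2 near1 near2 => N Nr NM.
have h0 := @mesh_gt0 R N.
pose D x := (mesh N)^-1 * (f (mesh N *: evec j + x) + (-1) * f x).
have D0 : rsum N D = 0.
  rewrite /D rsumZ (rsumD N (fun x => f (mesh N *: evec j + x)) (fun x => -1 * f x)).
  by rewrite rsumZ (rsum_shift _ NM f0) mulN1r subrr mulr0.
have -> : rsum N df = rsum N (fun x => df x + -1 * D x).
  by rewrite (rsumD N df (fun x => -1 * D x)) rsumZ D0 mulr0 addr0.
have -> : e = d * (32 * M1) ^+ n by rewrite /d divfK ?gt_eqF.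
apply: rsum_sup => //; first exact: ltW.
  move=> x /MM1 xM; rewrite df0; last by lra.
  suff f00 : f (mesh N *: evec j + x) = 0.
    by rewrite /D f00 f0 ?(mulr0, addr0, normr0) ?ltW//; lra.
  apply: f0; have := lerB_normD x (mesh N *: evec j).
  rewrite [x + _]addrC normrZ gtr0_norm// => h.
  apply: (lt_le_trans _ h); have := mesh_le1 (R:=R) N.
  have := ler_pM (ltW h0) (normr_ge0 (evec j : 'rV[R]_n)) (mesh_le1 N) ne.
  lra.
move=> x xM.
have [s sh] := @MVT_around R (fun r : R => f (r *: evec j + x))
  (fun s => df (s *: evec j + x)) 0 (mesh N) (fun s _ => line x s).
rewrite addr0 scale0r add0r => E; rewrite /D mulN1r mulN1r E mulrC mulfK ?gt_eqF//.
rewrite distrC ltW//.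
have bs : ball (0 : R) r s.
  rewrite -ball_normE/= distrC (le_lt_trans sh)//.
  by rewrite gtr0_norm.
by have := Hr _ bs _ xM; rewrite /G/= scale0r add0r.
Qed.

End RVIntCalculus.
(** * From classical solutions to functions continuous across t = 1 *)

Section Schwarz.
Context {R : realType} {n : nat}.

(** Schwarz's theorem: both mixed derivatives, at points close to [(t, x)], equal the same
    second difference quotient. *)
Lemma mixed_partials_eq (u v w c d : R * 'rV[R]_n -> R) (j : 'I_n)
    (a b t : R) (x : 'rV[R]_n) : a < t < b ->
  (forall s y, a < s < b -> is_derive s 1 (fun s : R => u (s, y)) (v (s, y))) ->
  (forall s y, a < s < b -> is_derive s 1 (fun s : R => w (s, y)) (c (s, y))) ->
  (forall s y, a < s < b -> is_derive y (evec j) (fun y => u (s, y)) (w (s, y))) ->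
  (forall s y, a < s < b -> is_derive y (evec j) (fun y => v (s, y)) (d (s, y))) ->
  {for (t, x), continuous c} -> {for (t, x), continuous d} ->
  c (t, x) = d (t, x).
Proof.
move=> /andP[at_ tb] uv wc uw vd cc cd.
apply/eqP; rewrite -subr_eq0 -normr_le0; apply/ler_addgt0Pr => e e0; rewrite add0r.
have e2 : 0 < e / 2 by rewrite divr_gt0.
have /cvgrPdist_lt/(_ _ e2)/nbhs_ballP[r1 /= r10 H1] := cc.
have /cvgrPdist_lt/(_ _ e2)/nbhs_ballP[r2 /= r20 H2] := cd.
(* A step for which both mean value points stay in the slab and in the
   two balls of continuity. *)
pose h := Num.min (Num.min (r1 / 2) (r2 / 2)) (Num.min ((b - t) / 2) ((t - a) / 2)).
have h0 : 0 < h by rewrite /h !lt_min !divr_gt0// subr_gt0.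
have hr1 : h < r1.
  by rewrite /h !gt_min; apply/orP; left; apply/orP; left; lra.
have hr2 : h < r2.
  by rewrite /h !gt_min; apply/orP; left; apply/orP; right; lra.
have hb : h < b - t.
  by rewrite /h !gt_min; apply/orP; right; apply/orP; left; lra.
have ha : h < t - a.
  by rewrite /h !gt_min; apply/orP; right; apply/orP; right; lra.
have inI s : `|s - t| <= `|h| -> a < s < b.
  by rewrite (gtr0_norm h0) ler_norml; lra.
have line (f f' : R * 'rV[R]_n -> R) (s k : R) :
    (forall y, is_derive y (evec j) (fun y => f (s, y)) (f' (s, y))) ->
    is_derive k 1 (fun k : R => f (s, k *: evec j + x)) (f' (s, k *: evec j + x)).
  move=> ff'.
  exact: (proj1 (@is_derive_line R _ (fun y => f (s, y)) x (evec j) k _) (ff' _)).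
have inb r s k : h < r -> `|s - t| <= `|h| -> `|k - 0| <= `|h| ->
    ball (t, x) r (s, k *: evec j + x).
  move=> hr; rewrite (gtr0_norm h0) subr0 => st k0.
  split; rewrite -ball_normE/=; first by rewrite distrC (le_lt_trans st).
  rewrite opprD addrCA subrr addr0 normrN normrZ (le_lt_trans _ hr)//.
  by rewrite (le_trans _ k0)// ler_piMr// norm_evec.
have [s1 s1h E1] : exists2 s, `|s - t| <= `|h| &
    (u (h + t, h *: evec j + x) - u (h + t, x)) -
    (u (t, h *: evec j + x) - u (t, x)) =
    (v (s, h *: evec j + x) - v (s, x)) * h.
  apply: (@MVT_around R (fun s => u (s, h *: evec j + x) - u (s, x))
    (fun s => v (s, h *: evec j + x) - v (s, x)) t h) => s /inI sI.
  by apply: is_deriveB; exact: uv.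
have [k1 k1h E2] : exists2 k, `|k - 0| <= `|h| &
    v (s1, h *: evec j + x) - v (s1, x) = d (s1, k *: evec j + x) * h.
  have := @MVT_around R (fun k => v (s1, k *: evec j + x))
    (fun k => d (s1, k *: evec j + x)) 0 h.
  rewrite addr0 scale0r add0r; apply => k _; apply: line => y.
  exact: vd (inI _ s1h).
have [k2 k2h E3] : exists2 k, `|k - 0| <= `|h| &
    (u (h + t, h *: evec j + x) - u (t, h *: evec j + x)) -
    (u (h + t, x) - u (t, x)) =
    (w (h + t, k *: evec j + x) - w (t, k *: evec j + x)) * h.
  have := @MVT_around R
    (fun k => u (h + t, k *: evec j + x) - u (t, k *: evec j + x))
    (fun k => w (h + t, k *: evec j + x) - w (t, k *: evec j + x)) 0 h.
  rewrite addr0 scale0r add0r; apply => k _.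
  apply: is_deriveB; apply: line => y; apply: uw.
    by apply: inI; rewrite addrK.
  by apply/andP.
have [s2 s2h E4] : exists2 s, `|s - t| <= `|h| &
    w (h + t, k2 *: evec j + x) - w (t, k2 *: evec j + x) =
    c (s, k2 *: evec j + x) * h.
  apply: (@MVT_around R (fun s => w (s, k2 *: evec j + x))
    (fun s => c (s, k2 *: evec j + x)) t h) => s /inI sI.
  exact: wc.
have E : c (s2, k2 *: evec j + x) = d (s1, k1 *: evec j + x).
  apply: (mulIf (lt0r_neq0 h0)); apply: (mulIf (lt0r_neq0 h0)).
  by rewrite -E4 -E3 -E2 -E1; ring.
have := H1 _ (inb _ _ _ hr1 s2h k2h); have := H2 _ (inb _ _ _ hr2 s1h k1h).
rewrite /= E => A1 A2.
have -> : c (t, x) - d (t, x) = (c (t, x) - d (s1, k1 *: evec j + x)) -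
  (d (t, x) - d (s1, k1 *: evec j + x)) by ring.
rewrite (le_trans (ler_normB _ _))//; lra.
Qed.

End Schwarz.

Section Solutions.
Context {R : realType} {n : nat}.
Implicit Types (f : R * 'rV[R]_n -> R) (x : 'rV[R]_n).

(** Freezing the time at 1 below 1 turns continuity within the slab, which is one-sided
    at the initial time, into continuity on a neighbourhood. *)
Definition clamp f : R * 'rV[R]_n -> R := fun z => f (Num.max 1 z.1, z.2).

Lemma clampE f t x : 1 <= t -> clamp f (t, x) = f (t, x).
Proof. by move=> t1; rewrite /clamp/=; congr (f (_, _)); apply/max_idPr. Qed.

Lemma clamp_continuous (T : \bar R) f (t : R) x : (1 < T)%E -> (t%:E < T)%E ->
  {within slab T, continuous f} -> {for (t, x), continuous (clamp f)}.
Proof.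
move=> T1 tT /subspace_continuousP cf.
pose c (z : R * 'rV[R]_n) : R * 'rV[R]_n := (Num.max 1 z.1, z.2).
have maxT (s : R) : (s%:E < T)%E -> ((Num.max 1 s)%:E < T)%E.
  by rewrite /Num.max; case: ifP.
have Sc : slab T (c (t, x)).
  by split; rewrite /c/= ?le_max ?lexx//; exact: maxT.
have cc : c z @[z --> (t, x)] --> c (t, x).
  apply: (@cvg_pair _ _ _ (nbhs (t, x)) (nbhs (Num.max 1 t)) (nbhs x) _ _ _
    (fun z : R * 'rV[R]_n => Num.max 1 z.1) snd).
    apply: (@continuous_max R (R * 'rV[R]_n)%type (fun=> 1) fst (t, x)).
      exact: cvg_cst.
    exact: cvg_fst.
  exact: cvg_snd.
have nS : \forall z \near (t, x), slab T (c z).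
  have tT' : \forall s \near t, (s%:E < T)%E.
    case: T tT {T1 cf maxT Sc} => [r| |] tr.
    - have H : \forall s \near t, s < r by apply: lt_nbhsl; rewrite -lte_fin.
      by near=> s; rewrite lte_fin; near: s.
    - by near=> s; rewrite ltry.
    - by near=> s.
  have f1 : fst z @[z --> (t, x)] --> t by exact: cvg_fst.
  have nz : \forall z \near (t, x), (z.1%:E < T)%E by exact: (f1 _ tT').
  near=> z; split; rewrite /c/= ?le_max ?lexx//.
  by apply: maxT; near: z.
have := cf _ Sc; apply: cvg_trans.
move=> A; rewrite /within/= /nbhs/= => HA.
have := cc _ HA; apply: filterS2 nS => z Sz; exact.
Unshelve. all: by end_near. Qed.

(** What the proof uses of a classical solution, on times below a real endpoint [b], for
    the solution and its derivatives frozen below time 1: [v] and [a] are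
    the first two time derivatives, [w j] and [c j] the first two derivatives
    along axis [j], [d j] the common value of the mixed ones. *)
Record wave_solution (alpha mu p eps b : R) (u0 u1 : 'rV[R]_n -> R)
    (u v a : R * 'rV[R]_n -> R) (w c d : 'I_n -> R * 'rV[R]_n -> R) : Prop := {
  ws_cont : forall t x, t < b ->
    [/\ {for (t, x), continuous u}, {for (t, x), continuous v} &
        {for (t, x), continuous a}];
  ws_contj : forall t x j, t < b ->
    [/\ {for (t, x), continuous (w j)}, {for (t, x), continuous (c j)} &
        {for (t, x), continuous (d j)}];
  ws_dt : forall t x, 1 < t < b ->
    is_derive t 1 (fun s : R => u (s, x)) (v (t, x)) /\
    is_derive t 1 (fun s : R => v (s, x)) (a (t, x));
  ws_dtj : forall t x j, 1 < t < b ->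
    is_derive t 1 (fun s : R => w j (s, x)) (d j (t, x));
  ws_dx : forall t x j, t < b ->
    [/\ is_derive x (evec j) (fun y => u (t, y)) (w j (t, x)),
        is_derive x (evec j) (fun y => v (t, y)) (d j (t, x)) &
        is_derive x (evec j) (fun y => w j (t, y)) (c j (t, x))];
  ws_eq : forall t x, 1 < t < b ->
    a (t, x) = (t `^ (2 * alpha))^-1 * \sum_j c j (t, x) - mu / t * v (t, x)
      + `|v (t, x)| `^ p;
  ws_past : forall t x, t <= 1 -> u (t, x) = u (1, x) /\ v (t, x) = v (1, x);
  ws_u0 : forall x, u (1, x) = eps * u0 x;
  ws_u1 : forall x, v (1, x) = eps * u1 x }.

Lemma Ck_slab_clamp (b : R) (T : \bar R) f : (1 < T)%E -> (b%:E <= T)%E ->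
  Ck_slab 1 T f ->
  [/\ forall t x, t < b -> {for (t, x), continuous (clamp f)} /\
        {for (t, x), continuous (clamp (pdt T f))},
      forall t x j, t < b -> {for (t, x), continuous (clamp (pdx T j f))},
      forall t x, 1 < t < b ->
        is_derive t 1 (fun s : R => clamp f (s, x)) (clamp (pdt T f) (t, x)) &
      forall t x j, t < b ->
        is_derive x (evec j) (fun y => clamp f (t, y)) (clamp (pdx T j f) (t, x))].
Proof.
move=> T1 bT [cf H].
have ltT (t : R) : t < b -> (t%:E < T)%E.
  by move=> tb; apply: lt_le_trans bT; rewrite lte_fin.
have [Dt [ct _]] := H dir_t (or_introl erefl).
have HX j := H (dir_x j) (or_intror (ex_intro2 _ _ j I erefl)).
split.
- move=> t x /ltT tT; split;
    [exact: (clamp_continuous T1 tT cf)|exact: (clamp_continuous T1 tT ct)].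
- by move=> t x j /ltT tT; have [_ [cx _]] := HX j;
    exact: (clamp_continuous T1 tT cx).
- move=> t x /andP[t1 tb]; have tT := ltT _ tb.
  have nS : nbhs (t, x) (slab T).
    exists ([set s | 1 < s] `&` [set s | s < b], setT).
      split=> /=; last exact: filterT.
      by apply: filterI; [exact: lt_nbhsr|exact: lt_nbhsl].
    by move=> z /= [[z1 zb] _]; split; [exact: ltW|exact: ltT].
  have St : slab T (t, x) by exact: nbhs_singleton.
  have D := Dt _ St; rewrite (derivable_within_interior _ _ nS) in D.
  rewrite clampE; last exact: ltW.
  have -> : pdt T f (t, x) = 'D_(dir_t) f (t, x) by exact: derive_within_interior.
  apply: (@near_eq_is_derive _ _ _ (fun s : R => f (s, x))).
    have H1 : \forall s \near t, 1 < s by exact: lt_nbhsr.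
    by near=> s; rewrite clampE// ltW//; near: s.
  have E : (fun h : R => h^-1 *: (f (h *: (dir_t : spacetime) + (t, x)) - f (t, x))) =
    (fun h : R => h^-1 *: (f (h *: (1 : R) + t, x) - f (t, x))).
    apply/funext => h; congr (_ *: (f _ - _)).
    by congr (_, _); rewrite /= scaler0 add0r.
  by apply: DeriveDef; rewrite /derivable /derive -E.
move=> t x j tb; have [Dx _] := HX j.
have St : slab T (Num.max 1 t, x).
  split; rewrite /= ?le_max ?lexx//.
  by rewrite /Num.max; case: ifP => // _; exact: ltT.
have I0 : increments (slab T) (Num.max 1 t, x) (dir_x j) = (0 : R)^'.
  rewrite /increments (_ : [set h : R | _] = setT).
    by apply/seteqP; split=> A; rewrite /within /= => HA; apply: filterS HA => h; [exact|].
  apply/seteqP; split=> // h _ /=.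
  by rewrite /slab/= /GRing.scale/= mulr0 add0r.
have := Dx _ St; rewrite /derivable_within I0 => D.
rewrite /clamp/= /pdx /derive_within I0.
have E : (fun h : R => h^-1 *: (f (h *: (dir_x j : spacetime) + (Num.max 1 t, x))
      - f (Num.max 1 t, x))) =
    (fun h : R => h^-1 *: (f (Num.max 1 t, h *: evec j + x) - f (Num.max 1 t, x))).
  apply/funext => h; congr (_ *: (f _ - _)).
  by congr (_, _); rewrite /= scaler0 add0r.
by apply: DeriveDef; rewrite /derivable /derive -E.
Unshelve. all: by end_near. Qed.

Lemma classical_wave_solution (alpha mu p eps b : R) (u0 u1 : 'rV[R]_n -> R)
    (T : \bar R) (u : R * 'rV[R]_n -> R) : (1 < T)%E -> (b%:E <= T)%E ->
  classical_solution alpha mu p eps u0 u1 T u ->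
  wave_solution alpha mu p eps b u0 u1 (clamp u) (clamp (pdt T u))
    (clamp (pdt T (pdt T u))) (fun j => clamp (pdx T j u))
    (fun j => clamp (pdx T j (pdx T j u))) (fun j => clamp (pdx T j (pdt T u))).
Proof.
move=> T1 bT [C2 Eq U0 U1].
have C1 : Ck_slab 1 T u.
  split; first by have [] := C2.
  move=> v Bv; have [_ /(_ v Bv)[D [c _]]] := C2.
  by split=> //; split.
have C1t : Ck_slab 1 T (pdt T u).
  by have [_ /(_ dir_t (or_introl erefl))[]] := C2.
have C1x j : Ck_slab 1 T (pdx T j u).
  by have [_ /(_ (dir_x j) (or_intror (ex_intro2 _ _ j I erefl)))[]] := C2.
have [cu cux ut ux] := Ck_slab_clamp T1 bT C1.
have [cv cvx vt vx] := Ck_slab_clamp T1 bT C1t.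
have Cx j := Ck_slab_clamp T1 bT (C1x j).
split.
- by move=> t x tb; have [? ?] := cu t x tb; have [? ?] := cv t x tb.
- move=> t x j tb; have [_ H _ _] := Cx j.
  by split; [exact: cux|exact: H|exact: cvx].
- by move=> t x tb; split; [exact: ut|exact: vt].
- move=> t x j tb; have [H1 _ H2 _] := Cx j.
  have [_ tb'] := andP tb.
  suff <- : clamp (pdt T (pdx T j u)) (t, x) = clamp (pdx T j (pdt T u)) (t, x).
    exact: H2.
  have ux' s y : 1 < s < b ->
      is_derive y (evec j) (fun y => clamp u (s, y)) (clamp (pdx T j u) (s, y)).
    by move=> /andP[_ sb]; exact: ux.
  have vx' s y : 1 < s < b -> is_derive y (evec j)
      (fun y => clamp (pdt T u) (s, y)) (clamp (pdx T j (pdt T u)) (s, y)).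
    by move=> /andP[_ sb]; exact: vx.
  have [_ cd] := H1 t x tb'.
  exact: (mixed_partials_eq tb ut H2 ux' vx' cd (cvx t x j tb')).
- move=> t x j tb; have [_ _ _ H] := Cx j.
  by split; [exact: ux|exact: vx|exact: H].
- move=> t x /andP[t1 tb]; have t1' := ltW t1.
  have tT : (t%:E < T)%E by apply: lt_le_trans bT; rewrite lte_fin.
  have E f : clamp f (t, x) = f (t, x) by exact: clampE.
  under eq_bigr do rewrite E.
  by rewrite !E -(Eq t x t1 tT) /laplacian; ring.
- by move=> t x t1; rewrite /clamp/= maxxx (max_idPl t1).
- by move=> x; rewrite (clampE u x (lexx 1)) U0.
- by move=> x; rewrite (clampE (pdt T u) x (lexx 1)) U1.
Qed.

End Solutions.
(** * Pointwise rules of calculus, and the squared Euclidean norm *)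

Section ContinuityRules.
Context {R : realType} {V : topologicalType}.
Implicit Types (f g : V -> R) (z : V).

Lemma cont_cst (k : R) z : {for z, continuous (fun=> k : R)}.
Proof. exact: cvg_cst. Qed.

Lemma contD f g z : {for z, continuous f} -> {for z, continuous g} ->
  {for z, continuous (fun y => f y + g y)}.
Proof. by move=> cf cg; exact: cvgD. Qed.

Lemma contN f z : {for z, continuous f} -> {for z, continuous (fun y => - f y)}.
Proof. by move=> cf; exact: cvgN. Qed.

Lemma contB f g z : {for z, continuous f} -> {for z, continuous g} ->
  {for z, continuous (fun y => f y - g y)}.
Proof. by move=> cf cg; exact: cvgB. Qed.

Lemma contM f g z : {for z, continuous f} -> {for z, continuous g} ->
  {for z, continuous (fun y => f y * g y)}.
Proof. by move=> cf cg; exact: cvgM. Qed.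

Lemma contX2 f z : {for z, continuous f} ->
  {for z, continuous (fun y => f y ^+ 2)}.
Proof. by move=> cf; exact: contM. Qed.

Lemma cont_max0 f z : {for z, continuous f} ->
  {for z, continuous (fun y => Num.max (f y) 0)}.
Proof.
by move=> cf; apply: (@continuous_max R V f (fun=> 0)) => //; exact: cvg_cst.
Qed.

Lemma cont_sum (I : finType) (F : I -> V -> R) z :
  (forall i, {for z, continuous (F i)}) ->
  {for z, continuous (fun y => \sum_i F i y)}.
Proof.
move=> cF.
suff -> : (fun y => \sum_i F i y) =
    \big[(fun f g : V -> R => fun y => f y + g y)/(fun=> 0)]_i F i.
  apply: (big_ind (fun h : V -> R => {for z, continuous h})) => //.
    exact: cont_cst.
  by move=> f g cf cg; exact: contD.
by apply/funext => y; elim/big_rec2 : _ => //= i a b _ ->.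
Qed.

Lemma cont_comp (f : V -> R) (g : R -> R) z :
  {for z, continuous f} -> {for f z, continuous g} ->
  {for z, continuous (fun y => g (f y))}.
Proof. by move=> cf cg; exact: (@continuous_comp _ _ _ f g). Qed.

End ContinuityRules.

Section DerivativeRules.
Context {R : realType} {V : normedModType R}.
Implicit Types (f g : V -> R) (x v : V).

Lemma drv_cst (k : R) x v : is_derive x v (fun=> k : R) 0.
Proof. exact: is_derive_cst. Qed.

Lemma drvD f g x v (df dg : R) : is_derive x v f df -> is_derive x v g dg ->
  is_derive x v (fun y => f y + g y) (df + dg).
Proof. by move=> ? ?; exact: is_deriveD. Qed.

Lemma drvB f g x v (df dg : R) : is_derive x v f df -> is_derive x v g dg ->
  is_derive x v (fun y => f y - g y) (df - dg).
Proof. by move=> ? ?; exact: is_deriveB. Qed.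

Lemma drvM f g x v (df dg : R) : is_derive x v f df -> is_derive x v g dg ->
  is_derive x v (fun y => f y * g y) (df * g x + f x * dg).
Proof.
move=> ? ?; apply: (is_derive_eq (is_deriveM _ _)).
by rewrite /GRing.scale/= addrC mulrC.
Qed.

Lemma drvX2 f x v (df : R) : is_derive x v f df ->
  is_derive x v (fun y => f y ^+ 2) (2 * f x * df).
Proof. by move=> ?; apply: (is_derive_eq (drvM _ _)); ring. Qed.

Lemma drv_sum m (F : 'I_m -> V -> R) (dF : 'I_m -> R) x v :
  (forall i, is_derive x v (F i) (dF i)) ->
  is_derive x v (fun y => \sum_i F i y) (\sum_i dF i).
Proof.
by move=> H; have := is_derive_sum H; rewrite fct_sumE.
Qed.

Lemma drv_comp (f : V -> R) (g : R -> R) x v (df dg : R) :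
  is_derive x v f df -> is_derive (f x) 1 g dg ->
  is_derive x v (fun y => g (f y)) (dg * df).
Proof.
move=> fx gx.
have fl : is_derive (0 : R) 1 (fun h : R => f (h *: v + x)) df.
  by apply: (proj1 (@is_derive_line R V f x v 0 df)); rewrite scale0r add0r.
have f0 : f (0 *: v + x) = f x by rewrite scale0r add0r.
have gx' : is_derive (f (0 *: v + x)) 1 g dg by rewrite f0.
suff : is_derive (0 : R) 1 (fun h : R => g (f (h *: v + x))) (dg * df).
  move=> /(proj2 (@is_derive_line R V (fun y => g (f y)) x v 0 _)).
  by rewrite scale0r add0r.
exact: (@is_derive1_comp R g (fun h : R => f (h *: v + x))).
Qed.

(** A criterion that spares the case analysis at the kink of the squared
    positive part. *)
Lemma is_derive_quadratic_error (f : R -> R) (t d : R) :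
  (forall h, `|f (h + t) - f t - d * h| <= h ^+ 2) -> is_derive t 1 f d.
Proof.
move=> H.
suff L : h^-1 *: (f (h *: (1 : R) + t) - f t) @[h --> (0 : R)^'] --> d.
  by apply: DeriveDef; [apply/cvg_ex; eexists; exact: L|exact: cvg_lim].
apply/cvgrPdist_lt => e e0; rewrite near_withinE; apply/nbhs_ballP.
exists e => //= h; rewrite -ball_normE/= sub0r normrN => he h0.
rewrite [h *: 1]mulr1 -[h^-1 *: _]/(h^-1 * _).
have -> : d - h^-1 * (f (h + t) - f t) = - (h^-1 * (f (h + t) - f t - d * h)).
  by field.
apply: le_lt_trans he; rewrite normrN normrM normfV ler_pdivrMl ?normr_gt0//.
by rewrite (le_trans (H h))// -normrM -expr2 ler_norm.
Qed.

Lemma drv_pos_part_sq f x v (df : R) : is_derive x v f df ->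
  is_derive x v (fun y => Num.max (f y) 0 ^+ 2) (2 * Num.max (f x) 0 * df).
Proof.
move=> fx; apply: (@drv_comp f (fun s => Num.max s 0 ^+ 2)) => //.
apply: is_derive_quadratic_error => h; rewrite ler_norml.
have [h1|h1] := leP (h + f x) 0; have [h2|h2] := leP (f x) 0;
  by apply/andP; split; nra.
Qed.

End DerivativeRules.

Section SquaredNorm.
Context {R : realType} {n : nat}.
Implicit Types x y : 'rV[R]_n.

Definition sqn x : R := \sum_j x ord0 j ^+ 2.

Lemma sqn_ge0 x : 0 <= sqn x.
Proof. by rewrite sumr_ge0// => j _; rewrite sqr_ge0. Qed.

Lemma sqn_coord x j : x ord0 j ^+ 2 <= sqn x.
Proof.
by rewrite /sqn (bigD1 j)//= lerDl sumr_ge0// => i _; rewrite sqr_ge0.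
Qed.

Lemma norm_le_sqn x (M : R) : 0 <= M -> sqn x <= M ^+ 2 -> `|x| <= M.
Proof.
move=> M0 xM; apply: norm_le_coord => // i.
by rewrite -ler_sqr ?nnegrE// real_normK ?num_real// (le_trans (sqn_coord _ _)).
Qed.


(** The triangle inequality of the Euclidean norm, by Young's inequality in each
    coordinate with the weights for which it is sharp. *)
Lemma sqnD_le x y (a b : R) : 0 < a -> 0 < b -> sqn x <= a ^+ 2 ->
  sqn y <= b ^+ 2 -> sqn (x + y) <= (a + b) ^+ 2.
Proof.
move=> a0 b0 xa yb.
have E : sqn (x + y) <= (1 + b / a) * sqn x + (1 + a / b) * sqn y.
  rewrite /sqn !mulr_sumr -big_split/=; apply: ler_sum => j _; rewrite mxE.
  move: (x _ _) (y _ _) => s t; rewrite -subr_ge0.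
  have -> : (1 + b / a) * s ^+ 2 + (1 + a / b) * t ^+ 2 - (s + t) ^+ 2 =
      (b * s - a * t) ^+ 2 / (a * b).
    by field; rewrite !gt_eqF.
  by rewrite divr_ge0 ?sqr_ge0// mulr_ge0// ltW.
apply: (le_trans E).
have -> : (a + b) ^+ 2 = (1 + b / a) * a ^+ 2 + (1 + a / b) * b ^+ 2.
  by field; rewrite !gt_eqF.
by apply: lerD; apply: ler_wpM2l => //; rewrite addr_ge0// divr_ge0// ltW.
Qed.

Lemma drv_coord x (i j : 'I_n) :
  is_derive x (evec j) (fun y : 'rV[R]_n => y ord0 i) (i == j)%:R.
Proof.
have E : (fun h : R => h^-1 *: ((h *: evec j + x) ord0 i - x ord0 i)) @ (0 : R)^'
    --> ((i == j)%:R : R).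
  apply/cvgrPdist_lt => e e0; near=> h.
  have h0 : h != 0 by near: h; exact: nbhs_dnbhs_neq.
  rewrite !mxE eqxx/= addrK -[_ *: _]/(h^-1 * _) mulrA mulVf// mul1r subrr.
  by rewrite normr0.
by apply: DeriveDef; [apply/cvg_ex; eexists; exact: E|exact: cvg_lim].
Unshelve. all: by end_near. Qed.

Lemma drv_sqn x x0 (j : 'I_n) :
  is_derive x (evec j) (fun y : 'rV[R]_n => sqn (y - x0)) (2 * (x - x0) ord0 j).
Proof.
have H i : is_derive x (evec j) (fun y : 'rV[R]_n => (y - x0) ord0 i ^+ 2)
    (2 * (x - x0) ord0 i * (i == j)%:R).
  apply: (@drvX2 _ _ (fun y : 'rV[R]_n => (y - x0) ord0 i)).
  rewrite (_ : (fun y => _) = (fun y : 'rV[R]_n => y ord0 i - x0 ord0 i)).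
    rewrite -[(i == j)%:R]subr0; exact: (drvB (drv_coord x i j) (drv_cst _ _ _)).
  by apply/funext => y; rewrite !mxE.
have := drv_sum H; rewrite (bigD1 j)//= eqxx mulr1 big1 ?addr0// => i /negbTE ->.
by rewrite mulr0.
Qed.

Lemma cont_coord (T : topologicalType) (f : T -> 'rV[R]_n) (i : 'I_n) (z : T) :
  {for z, continuous f} -> {for z, continuous (fun t => f t ord0 i)}.
Proof.
move=> cf; apply: (@continuous_comp _ _ _ f (fun x : 'rV[R]_n => x ord0 i)) => //.
exact: coord_continuous.
Qed.

Lemma cont_sqn (T : topologicalType) (f : T -> 'rV[R]_n) (z : T) :
  {for z, continuous f} -> {for z, continuous (fun t => sqn (f t))}.
Proof. by move=> cf; apply: cont_sum => i; apply: contX2; exact: cont_coord. Qed.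

End SquaredNorm.
(** * Finite speed of propagation *)

Section FiniteSpeed.
Context {R : realType} {n : nat}.
Implicit Types (x y : 'rV[R]_n) (s t : R).

(** The distance travelled between times 1 and [t] at the speed t^(-alpha) of the
    equation. *)
Definition phase (alpha t : R) : R := (t `^ (1 - alpha) - 1) / (1 - alpha).

Lemma drv_phase (alpha t : R) : alpha < 1 -> 0 < t ->
  is_derive t 1 (phase alpha) (t `^ (- alpha)).
Proof.
move=> a1 t0; have a1' : 1 - alpha != 0 by rewrite gt_eqF// subr_gt0.
have H := is_derive1_powR (1 - alpha) t0.
apply: (is_derive_eq (drvM (drvB H (drv_cst 1 t 1)) (drv_cst (1 - alpha)^-1 t 1))).
rewrite mulr0 addr0 subr0 (_ : 1 - alpha - 1 = - alpha); last by ring.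
by rewrite mulrAC mulfV// mul1r.
Qed.

Lemma phase1 (alpha : R) : phase alpha 1 = 0.
Proof. by rewrite /phase powR1 subrr mul0r. Qed.

Lemma phase_le (alpha s t : R) : alpha < 1 -> 0 <= s -> s <= t ->
  phase alpha s <= phase alpha t.
Proof.
move=> a1 s0 st; rewrite ler_pM2r ?invr_gt0 ?subr_gt0// lerD2r.
by rewrite ge0_ler_powR// ?nnegrE ?subr_ge0 ?(ltW a1)// (le_trans s0).
Qed.

Lemma phase_ge0 (alpha t : R) : alpha < 1 -> 1 <= t -> 0 <= phase alpha t.
Proof. by move=> a1 t1; rewrite -(phase1 alpha) phase_le. Qed.

Lemma drv_cont (f : R -> R) t d : is_derive t 1 f d -> {for t, continuous f}.
Proof.
by move=> [D _]; apply/differentiable_continuous/derivable1_diffP.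
Qed.

Lemma cont_fst (f : R -> R) (z : R * 'rV[R]_n) : {for z.1, continuous f} ->
  {for z, continuous (fun z => f z.1)}.
Proof.
case: z => t x cf; apply: (@cont_comp R (R * 'rV[R]_n)%type fst f (t, x)) => //.
exact: cvg_fst.
Qed.

(** At distance at most [rho] from the axis of the cone, the energy flux is dominated by
    [rho] times the energy density, hence by the loss of energy due to the shrinking of
    the cone. *)
Lemma cone_flux_le (rho tau v : R) (y w : 'I_n -> R) : 0 < rho ->
  \sum_j y j ^+ 2 <= rho ^+ 2 ->
  2 * tau * v * \sum_j y j * w j <= rho * (v ^+ 2 + tau ^+ 2 * \sum_j w j ^+ 2).
Proof.
move=> r0 yr.
have H : 2 * tau * v * \sum_j y j * w j <=
    v ^+ 2 / rho * \sum_j y j ^+ 2 + rho * tau ^+ 2 * \sum_j w j ^+ 2.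
  rewrite !mulr_sumr -big_split/=; apply: ler_sum => j _; rewrite -subr_ge0.
  have -> : v ^+ 2 / rho * y j ^+ 2 + rho * tau ^+ 2 * w j ^+ 2 -
      2 * tau * v * (y j * w j) = (v * y j - rho * tau * w j) ^+ 2 / rho.
    by field; rewrite gt_eqF.
  by rewrite divr_ge0 ?sqr_ge0// ltW.
have H2 : v ^+ 2 / rho * \sum_j y j ^+ 2 <= rho * v ^+ 2.
  rewrite (_ : rho * v ^+ 2 = v ^+ 2 / rho * rho ^+ 2); last first.
    by field; rewrite gt_eqF.
  by rewrite ler_wpM2l// divr_ge0 ?sqr_ge0// ltW.
lra.
Qed.

(** The pointwise form of the energy estimate.  Here [s ^+ 2] is the cone weight,
    [A] the energy density, [tau] the speed t^(-alpha) and [G] the damping mu/t.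
    On the left stands the time derivative of [s ^+ 2 * A] minus the divergence
    [2 * tau ^+ 2 * \sum_j d_j (s ^+ 2 * v * w j)], expanded: the
    second order terms cancel, the derivatives of the weight have a favourable sign by
    [cone_flux_le], and the nonlinear term is a bounded multiple of
    [v ^+ 2] as long as [v] stays bounded. *)
Lemma energy_rate_le (rho tau tau' S s K M u v a A G p : R) (y w c d : 'I_n -> R) :
  1 < p -> 0 <= s -> 0 <= tau -> tau' <= 0 -> 0 <= G ->
  (0 < s -> 0 < rho /\ \sum_j y j ^+ 2 <= rho ^+ 2) ->
  `|v| <= M -> K = 1 + 2 * M `^ (p - 1) ->
  a = tau ^+ 2 * \sum_j c j - G * v + `|v| `^ p ->
  S = \sum_j w j ^+ 2 -> A = u ^+ 2 + v ^+ 2 + tau ^+ 2 * S ->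
  2 * s * (2 * rho * (- tau)) * A
  + s ^+ 2 * (2 * u * v + 2 * v * a + 2 * tau * tau' * S
              + tau ^+ 2 * \sum_j 2 * w j * d j)
  - 2 * tau ^+ 2 * \sum_j (2 * s * (- (2 * y j)) * (v * w j)
                           + s ^+ 2 * (d j * w j + v * c j))
  <= K * (s ^+ 2 * A).
Proof.
move=> p1 s0 tau0 tau'0 G0 Hs vM KE aE SE AE.
have S0 : 0 <= S by rewrite SE sumr_ge0// => j _; rewrite sqr_ge0.
have -> : \sum_j (2 * s * (- (2 * y j)) * (v * w j)
                  + s ^+ 2 * (d j * w j + v * c j)) =
   (- 4 * s * v) * \sum_j y j * w j + s ^+ 2 * \sum_j w j * d j
   + s ^+ 2 * v * \sum_j c j.
  by rewrite !mulr_sumr -!big_split/=; apply: eq_bigr => j _; ring.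
have -> : \sum_j 2 * w j * d j = 2 * \sum_j w j * d j.
  by rewrite mulr_sumr; apply: eq_bigr => j _; ring.
have flux : 4 * s * tau * (2 * tau * v * \sum_j y j * w j) <= 4 * s * tau * (rho * A).
  move: s0; rewrite le_eqVlt => /predU1P[<-|s0]; first by rewrite !(mulr0, mul0r).
  have [r0 yr] := Hs s0.
  apply: ler_wpM2l; first by rewrite !mulr_ge0// ltW.
  apply: (le_trans (cone_flux_le tau v w r0 yr)); apply: ler_wpM2l; first exact: ltW.
  by rewrite AE SE -addrA lerDr sqr_ge0.
have M0 : 0 <= M by rewrite (le_trans _ vM).
have nl : v * `|v| `^ p <= M `^ (p - 1) * v ^+ 2.
  rewrite -mulr_powRB1//; last by lra.
  apply: (@le_trans _ _ (`|v| * (`|v| * `|v| `^ (p - 1)))).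
    by apply: ler_wpM2r; [rewrite mulr_ge0// powR_ge0|exact: ler_norm].
  rewrite mulrA -expr2 real_normK ?num_real// mulrC.
  by apply: ler_wpM2r; rewrite ?sqr_ge0// ge0_ler_powR// ?nnegrE//; lra.
have K0 : 0 <= M `^ (p - 1) by exact: powR_ge0.
have bulk : 2 * u * v + 2 * v * (- G * v + `|v| `^ p) + 2 * tau * tau' * S <= K * A.
  have h1 : 0 <= G * v ^+ 2 by rewrite mulr_ge0// sqr_ge0.
  have h2 : tau * tau' * S <= 0 by rewrite mulr_le0_ge0// mulr_ge0_le0.
  have h3 : 0 <= tau ^+ 2 * S by rewrite mulr_ge0// sqr_ge0.
  have h4 : 0 <= M `^ (p - 1) * (u ^+ 2 + tau ^+ 2 * S).
    by rewrite mulr_ge0// addr_ge0// sqr_ge0.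
  have h5 : 0 <= (u - v) ^+ 2 by rewrite sqr_ge0.
  rewrite KE AE; lra.
have h : s ^+ 2 * (2 * u * v + 2 * v * (- G * v + `|v| `^ p) + 2 * tau * tau' * S)
  <= s ^+ 2 * (K * A) by rewrite ler_wpM2l// sqr_ge0.
rewrite aE; lra.
Qed.

Variables (alpha mu p eps b r : R) (u0 u1 : 'rV[R]_n -> R).
Variables (u v a : R * 'rV[R]_n -> R) (w c d : 'I_n -> R * 'rV[R]_n -> R).
Hypotheses (a0 : 0 <= alpha) (a1 : alpha < 1) (mu0 : 0 <= mu) (p1 : 1 < p).
Hypotheses (r0 : 0 < r) (b1 : 1 < b).
Hypothesis ws : wave_solution alpha mu p eps b u0 u1 u v a w c d.
Hypothesis supp0 : forall x, r ^+ 2 < sqn x -> u0 x = 0.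
Hypothesis supp1 : forall x, r ^+ 2 < sqn x -> u1 x = 0.

Lemma initial_support x : r ^+ 2 < sqn x ->
  [/\ u (1, x) = 0, v (1, x) = 0 & forall j, w j (1, x) = 0].
Proof.
move=> xr; split; first by rewrite (ws_u0 ws) supp0// mulr0.
  by rewrite (ws_u1 ws) supp1// mulr0.
move=> j; have [H _ _] := ws_dx ws x j b1.
have H' : is_derive (0 : R) 1 (fun h : R => u (1, h *: evec j + x)) (w j (1, x)).
  apply: (proj1 (@is_derive_line R _ (fun y => u (1, y)) x (evec j) 0 _)).
  by rewrite scale0r add0r.
apply: is_derive_near0 H'.
have C : {for (0 : R), continuous (fun h : R => sqn (h *: evec j + x))}.
  apply: cont_sqn; apply: cvgD; last exact: cvg_cst.
  exact: cvgZr_tmp cvg_id.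
have : r ^+ 2 < sqn (0 *: evec j + x) by rewrite scale0r add0r.
move=> /(cvgr_gt _ C); apply: filterS => h hr.
by rewrite (ws_u0 ws) supp0// mulr0.
Qed.

Section Cone.
Variables (t0 rho0 : R) (x0 : 'rV[R]_n).
Hypotheses (t01 : 1 < t0) (t0b : t0 < b).
Hypotheses (rho0t : phase alpha t0 < rho0) (far : (rho0 + r) ^+ 2 < sqn x0).

Let rho s := rho0 - phase alpha s.
Let tau s := s `^ (- alpha).
Let tau' s := (- alpha) * s `^ (- alpha - 1).
(** The weight is the square of [cone], a C^1 function supported in the backward cone
    over the ball of radius [rho0 - phase alpha t0] around [x0] at time [t0]. *)
Let cone (z : R * 'rV[R]_n) := Num.max (rho z.1 ^+ 2 - sqn (z.2 - x0)) 0.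
Let dens z := u z ^+ 2 + v z ^+ 2 + tau z.1 ^+ 2 * \sum_j w j z ^+ 2.
Let g z := cone z ^+ 2 * dens z.
Let g' z := 2 * cone z * (2 * rho z.1 * (- tau z.1)) * dens z
  + cone z ^+ 2 * (2 * u z * v z + 2 * v z * a z
     + 2 * tau z.1 * tau' z.1 * (\sum_j w j z ^+ 2)
     + tau z.1 ^+ 2 * \sum_j 2 * w j z * d j z).
Let flux j z := 2 * cone z * (- (2 * (z.2 - x0) ord0 j)) * (v z * w j z)
  + cone z ^+ 2 * (d j z * w j z + v z * c j z).

Let rho_cont s : 0 < s -> {for s, continuous rho}.
Proof.
by move=> s0; apply: contB; [exact: cont_cst|exact: drv_cont (drv_phase a1 s0)].
Qed.

Let tau_cont s : 0 < s -> {for s, continuous tau}.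
Proof. by move=> s0; exact: drv_cont (is_derive1_powR (- alpha) s0). Qed.

Let tau'_cont s : 0 < s -> {for s, continuous tau'}.
Proof.
move=> s0; apply: contM; first exact: cont_cst.
exact: drv_cont (is_derive1_powR (- alpha - 1) s0).
Qed.

Let cone_cont s x : 0 < s -> {for (s, x), continuous cone}.
Proof.
move=> s0; apply: cont_max0; apply: contB.
  by apply: contX2; apply: (@cont_fst rho); exact: rho_cont.
apply: cont_sqn; apply: cvgB; [exact: cvg_snd|exact: cvg_cst].
Qed.

Let sumw_cont s x : s < b ->
  {for (s, x), continuous (fun z => \sum_j w j z ^+ 2)}.
Proof.
by move=> sb; apply: cont_sum => j; apply: contX2; have [] := ws_contj ws x j sb.
Qed.

Let tau1_cont s x : 0 < s ->
  {for (s, x), continuous (fun z : R * 'rV[R]_n => tau z.1)}.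
Proof. by move=> s0; apply: (@cont_fst tau); exact: tau_cont. Qed.

Let dens_cont s x : 0 < s -> s < b -> {for (s, x), continuous dens}.
Proof.
move=> s0 sb; have [cu cv _] := ws_cont ws x sb.
apply: contD; first by apply: contD; exact: contX2.
by apply: contM; [apply: contX2; exact: tau1_cont|exact: sumw_cont].
Qed.

Let g_cont s x : 0 < s -> s < b -> {for (s, x), continuous g}.
Proof.
move=> s0 sb; apply: contM; last exact: dens_cont.
by apply: contX2; exact: cone_cont.
Qed.

Let g'_cont s x : 0 < s -> s < b -> {for (s, x), continuous g'}.
Proof.
move=> s0 sb; have [cu cv ca] := ws_cont ws x sb.
have cc := @cone_cont s x s0; have ct := @tau1_cont s x s0.
have k2 : {for (s, x), continuous (fun=> 2 : R)} by exact: cont_cst.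
apply: contD.
  apply: contM; last exact: dens_cont.
  apply: contM; first exact: contM.
  apply: contM.
    by apply: contM => //; apply: (@cont_fst rho); exact: rho_cont.
  exact: contN.
apply: contM; first exact: contX2.
apply: contD; last first.
  apply: contM; first exact: contX2.
  apply: cont_sum => j; have [cw _ cd] := ws_contj ws x j sb.
  by apply: contM => //; exact: contM.
apply: contD; last first.
  apply: contM; last exact: sumw_cont.
  apply: contM; first exact: contM.
  by apply: (@cont_fst tau'); exact: tau'_cont.
by apply: contD; apply: contM => //; exact: contM.
Qed.

Let flux_cont j s x : 0 < s -> s < b -> {for (s, x), continuous (flux j)}.
Proof.
move=> s0 sb; have [cu cv ca] := ws_cont ws x sb.
have [cw c_c cd] := ws_contj ws x j sb.
have cc := @cone_cont s x s0.
have k2 : {for (s, x), continuous (fun=> 2 : R)} by exact: cont_cst.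
apply: contD; last first.
  by apply: contM; [exact: contX2|apply: contD; exact: contM].
apply: contM; last exact: contM.
apply: contM; first exact: contM.
apply: contN; apply: contM => //.
apply: (@cont_coord _ _ _ (fun z : R * 'rV[R]_n => z.2 - x0)).
by apply: cvgB; [exact: cvg_snd|exact: cvg_cst].
Qed.

Let cone_supp s x (P : R) : `|rho s| <= P -> `|x0| + P < `|x| -> cone (s, x) = 0.
Proof.
move=> sP xP; apply/max_idPr; rewrite subr_le0.
have P0 : 0 <= P by rewrite (le_trans _ sP).
rewrite leNgt; apply/negP => H.
have : `|x - x0| <= P.
  apply: norm_le_sqn => //; rewrite (le_trans (ltW H))//.
  by rewrite -real_normK ?num_real// ler_sqr ?nnegrE.
have := lerB_dist x x0; lra.
Qed.

Let near_supp t : 0 < t -> t < b -> exists M : R,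
  \forall s \near t, [/\ 0 < s, s < b & forall x, M < `|x| -> cone (s, x) = 0].
Proof.
move=> tp tb; exists (`|x0| + (`|rho t| + 1)).
have H1 : \forall s \near t, 0 < s by exact: lt_nbhsr.
have H2 : \forall s \near t, s < b by exact: lt_nbhsl.
have H3 : \forall s \near t, `|rho s| < `|rho t| + 1.
  have C : `|rho s| @[s --> t] --> `|rho t| by apply: cvg_norm; exact: rho_cont.
  by apply: (cvgr_lt _ C); rewrite ltrDl.
move: H1 H2 H3; apply: filterS3 => s s0 sb sr; split=> // x.
by apply: cone_supp; exact: ltW.
Qed.

Let E s := rV_int (fun x => g (s, x)).

Let E_cont t : 0 < t -> t < b -> {for t, continuous E}.
Proof.
move=> tp tb; have [M HM] := near_supp tp tb.
apply: (@rV_int_continuous R n g t M); move: HM; apply: filterS => s [s0 sb H].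
  by move=> x; exact: g_cont.
by move=> x /H; rewrite /g => ->; rewrite expr0n mul0r.
Qed.

Let g_drv t x : 1 < t -> t < b ->
  is_derive t 1 (fun s : R => g (s, x)) (g' (t, x)).
Proof.
move=> t1 tb; have tI : 1 < t < b by rewrite t1.
have tp : 0 < t by lra.
have [du dv] := ws_dt ws x tI.
have dt := is_derive1_powR (- alpha) tp.
have dr := drvB (drv_cst rho0 t 1) (drv_phase a1 tp).
have dw := drv_sum (fun j => drvX2 (ws_dtj ws x j tI)).
have dd := drvD (drvD (drvX2 du) (drvX2 dv)) (drvM (drvX2 dt) dw).
have dc := drv_pos_part_sq (drvB (drvX2 dr) (drv_cst (sqn (x - x0)) t 1)).
apply: (is_derive_eq (drvM dc dd)).
rewrite /g' /dens /cone /tau /tau' /rho /=; ring.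
Qed.

Let E_drv t : 1 < t -> t < b ->
  is_derive t 1 E (rV_int (fun x => g' (t, x))).
Proof.
move=> t1 tb; have tp : 0 < t by lra.
have [M HM] := near_supp tp tb.
apply: (@rV_int_is_derive R n g g' t M).
- by move: HM; apply: filterS => s [s0 sb _] x; exact: g_cont.
- by move=> x; exact: g'_cont.
- have H1 : \forall s \near t, 1 < s by exact: lt_nbhsr.
  have H2 : \forall s \near t, s < b by exact: lt_nbhsl.
  by move: H1 H2; apply: filterS2 => s s1 sb x; exact: g_drv.
- move: HM; apply: filterS => s [s0 sb H] x /H.
  by rewrite /g => ->; rewrite expr0n mul0r.
Qed.

Let flux_int j t : 0 < t -> t < b -> rV_int (fun x => flux j (t, x)) = 0.
Proof.
move=> tp tb; have [M HM] := near_supp tp tb.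
have [_ _ supp] := nbhs_singleton HM.
apply: (@rV_int_partial0 R n (fun x => cone (t, x) ^+ 2 * (v (t, x) * w j (t, x)))
  _ j M).
- move=> x; have [_ dv dw] := ws_dx ws x j tb.
  have dc := drv_pos_part_sq
    (drvB (drv_cst (rho t ^+ 2) x (evec j)) (drv_sqn x x0 j)).
  apply: (is_derive_eq (drvM dc (drvM dv dw))).
  rewrite /flux /cone /=; ring.
- by apply: slice_continuous => x; exact: flux_cont.
- by move=> x /supp ->; rewrite expr0n mul0r.
Qed.

Let v_bounded : exists M : R, forall t x, 1 <= t <= t0 -> `|x| <= `|x0| + rho0 ->
  `|v (t, x)| <= M.
Proof.
have cK : compact (`[1, t0]%classic `*` [set x : 'rV[R]_n | `|x| <= `|x0| + rho0]).
  by apply: compact_setX; [exact: segment_compact|exact: compact_norm_le].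
have cv : {within `[1, t0]%classic `*` [set x : 'rV[R]_n | `|x| <= `|x0| + rho0],
    continuous v}.
  apply: continuous_in_subspaceT => -[t x]; rewrite inE => -[/= tI _].
  have tb : t < b.
    by move: tI; rewrite /= in_itv/= => /andP[_ tt0]; rewrite (le_lt_trans tt0).
  by have [] := ws_cont ws x tb.
have [B [_ HB]] := compact_bounded (continuous_compact cv cK).
exists (B + 1) => t x tI xM; apply: (HB (B + 1)); first by lra.
by exists (t, x) => //; split; rewrite /= ?in_itv.
Qed.

Let g_bsupp t : 0 < t -> t < b -> bsupp (fun x => g (t, x)).
Proof.
move=> tp tb; have [M HM] := near_supp tp tb.
have [_ _ supp] := nbhs_singleton HM.
apply: (@continuous_bsupp R n _ M).
  by apply: slice_continuous => x; exact: g_cont.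
by move=> x /supp H; rewrite /g H expr0n mul0r.
Qed.

Let g'_bsupp t : 0 < t -> t < b -> bsupp (fun x => g' (t, x)).
Proof.
move=> tp tb; have [M HM] := near_supp tp tb.
have [_ _ supp] := nbhs_singleton HM.
apply: (@continuous_bsupp R n _ M).
  by apply: slice_continuous => x; exact: g'_cont.
by move=> x /supp H; rewrite /g' H expr0n/= !(mulr0, mul0r) addr0.
Qed.

Let flux_bsupp j t : 0 < t -> t < b -> bsupp (fun x => flux j (t, x)).
Proof.
move=> tp tb; have [M HM] := near_supp tp tb.
have [_ _ supp] := nbhs_singleton HM.
apply: (@continuous_bsupp R n _ M).
  by apply: slice_continuous => x; exact: flux_cont.
by move=> x /supp H; rewrite /flux H expr0n/= !(mulr0, mul0r) addr0.
Qed.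

Let rho_ge0 t : 1 <= t <= t0 -> 0 < rho t <= rho0.
Proof.
move=> /andP[t1 tt0]; have tp : 0 <= t by lra.
have := phase_le a1 tp tt0; have := phase_ge0 a1 t1.
by move=> h1 h2; apply/andP; rewrite /rho; move: rho0t; split; lra.
Qed.

Let E_rate : exists K : R, forall t, 1 < t < t0 ->
  rV_int (fun x => g' (t, x)) <= K * E t.
Proof.
have [M HM] := v_bounded; exists (1 + 2 * M `^ (p - 1)) => t /andP[t1 tt0].
have tp : 0 < t by lra.
have tb : t < b by exact: lt_trans t0b.
have tI : 1 < t < b by rewrite t1.
have tI' : 1 <= t <= t0 by rewrite !ltW.
have /andP[rp rr] := rho_ge0 tI'.
have bf : bsupp (fun x => 2 * tau t ^+ 2 * \sum_j flux j (t, x)).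
  by apply: bsuppZ; apply: bsupp_sum => j; exact: flux_bsupp.
rewrite -[leLHS]subr0 -[X in _ - X](mulr0 (2 * tau t ^+ 2)).
have fm : \sum_j rV_int (fun x => flux j (t, x)) = 0.
  by apply: big1 => j _; exact: flux_int.
rewrite -[X in _ - _ * X]fm.
rewrite -rV_int_sum; last by move=> j; exact: flux_bsupp.
rewrite -rV_intZ; last by apply: bsupp_sum => j; exact: flux_bsupp.
rewrite -rV_intB//; last exact: g'_bsupp.
rewrite /E -rV_intZ; last exact: g_bsupp.
apply: rV_int_le; [by apply: bsuppB => //; exact: g'_bsupp
                |by apply: bsuppZ; exact: g_bsupp|].
move=> x.
have c0 : 0 <= cone (t, x) by rewrite /cone le_max lexx orbT.
have [xM|xM] := leP `|x| (`|x0| + rho0); last first.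
  have C : cone (t, x) = 0.
    by apply: (@cone_supp t x rho0) => //; rewrite gtr0_norm.
  have -> : \sum_j flux j (t, x) = 0.
    by apply: big1 => j _; rewrite /flux C expr0n/= !(mulr0, mul0r) addr0.
  by rewrite /g /g' C expr0n/= !(mulr0, mul0r, addr0, subr0).
have powE : (t `^ (2 * alpha))^-1 = tau t ^+ 2.
  rewrite -powRN expr2 -powRD; first by congr (t `^ _); ring.
  by rewrite implybE (gt_eqF tp) orbT.
have aE := ws_eq ws x tI; rewrite powE in aE.
apply: (@energy_rate_le (rho t) (tau t) (tau' t) _ (cone (t, x)) _ M (u (t, x))
  (v (t, x)) (a (t, x)) _ (mu / t) p (fun j => (x - x0) ord0 j)
  (fun j => w j (t, x)) (fun j => c j (t, x)) (fun j => d j (t, x))) => //.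
- exact: powR_ge0.
- by rewrite /tau' mulNr oppr_le0 mulr_ge0// powR_ge0.
- by rewrite divr_ge0// ltW.
- rewrite /cone lt_max ltxx orbF subr_gt0 => /ltW; split=> //.
- exact: HM.
Qed.

Let E1 : E 1 = 0.
Proof.
rewrite /E -[RHS](@rV_int0 R n); congr rV_int; apply/funext => x.
rewrite /g /cone/= /rho phase1 subr0.
have [h|h] := leP (rho0 ^+ 2 - sqn (x - x0)) 0; first by rewrite expr0n mul0r.
have rho0p : 0 < rho0.
  by apply: le_lt_trans rho0t; apply: phase_ge0 => //; exact: ltW.
suff xr : r ^+ 2 < sqn x.
  rewrite /dens; have [-> -> w0] := initial_support xr.
  rewrite big1; first by rewrite expr0n/= !(addr0, mulr0).
  by move=> j _; rewrite w0 expr0n.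
rewrite ltNge; apply/negP => xr.
have : sqn (x0 - x) <= rho0 ^+ 2.
  rewrite (_ : sqn (x0 - x) = sqn (x - x0)); first by rewrite ltW// -subr_gt0.
  by apply: eq_bigr => j _; rewrite !mxE; ring.
move=> /(sqnD_le rho0p r0)/(_ xr); rewrite subrK => H.
by move: far; rewrite ltNge H.
Qed.

(** The energy in the cone vanishes at time 1, since its base misses the support of the
    data, and grows at most exponentially. *)
Lemma cone_vanishing : [/\ u (t0, x0) = 0, v (t0, x0) = 0 &
  forall j, w j (t0, x0) = 0].
Proof.
have t0p : 0 < t0 by exact: lt_trans t01.
have [K HK] := E_rate.
have inI t : t \in `]1, t0[ -> [/\ 1 < t, 0 < t, t < b & 1 < t < t0].
  by rewrite in_itv/= => /andP[h1 h2]; split=> //; [lra|exact: lt_trans t0b|exact/andP].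
pose Phi t := E t * expR (- K * t).
have dex t : is_derive t 1 (fun t => expR (- K * t)) (expR (- K * t) * - K).
  have := drvM (drv_cst (- K) t 1) (is_derive_id t (1 : R)).
  rewrite mul0r add0r mulr1 => H.
  exact: drv_comp H (is_derive_expR _).
have dPhi t : t \in `]1, t0[ -> is_derive t 1 Phi
   ((rV_int (fun x => g' (t, x)) - K * E t) * expR (- K * t)).
  move=> /inI[t1 _ tb _]; apply: (is_derive_eq (drvM (E_drv t1 tb) (dex t))).
  by ring.
have E0 : E t0 <= 0.
  have : Phi t0 <= Phi 1.
    apply: (@ler0_derive1_le_cc R Phi 1 t0); rewrite ?in_itv/= ?lexx ?ltW//.
    - by move=> t /dPhi[].
    - move=> t tI; have [_ D] := dPhi t tI; rewrite derive1E D.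
      by rewrite pmulr_lle0 ?expR_gt0// subr_le0 HK//; have [] := inI t tI.
    - apply: continuous_in_subspaceT => t; rewrite inE/= in_itv/= => /andP[h1 h2].
      apply: contM; first by apply: E_cont; [lra|exact: le_lt_trans t0b].
      exact: drv_cont (dex t).
  by rewrite /Phi E1 mul0r pmulr_lle0// expR_gt0.
have dpos x : 0 <= dens (t0, x).
  rewrite /dens !addr_ge0// ?sqr_ge0// mulr_ge0 ?sqr_ge0// sumr_ge0// => j _.
  by rewrite sqr_ge0.
have d0 : dens (t0, x0) = 0.
  apply/eqP; rewrite eq_le dpos andbT leNgt; apply/negP => dp.
  move: E0; rewrite leNgt => /negP; apply.
  apply: (@rV_int_gt0 R n _ x0); first exact: g_bsupp.
  - by apply: slice_continuous => x; exact: g_cont.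
  - by move=> x; rewrite mulr_ge0// sqr_ge0.
  rewrite mulr_gt0// exprn_gt0// /cone/= lt_max subrr.
  rewrite (_ : sqn 0 = 0); last by rewrite /sqn big1// => j _; rewrite mxE expr0n.
  by rewrite subr0 exprn_gt0 ?orTb// subr_gt0.
have tau0 : 0 < tau t0 ^+ 2 by rewrite exprn_gt0// powR_gt0.
have S0 : 0 <= \sum_j w j (t0, x0) ^+ 2 by rewrite sumr_ge0// => j _; rewrite sqr_ge0.
have := sqr_ge0 (u (t0, x0)); have := sqr_ge0 (v (t0, x0)) => hv hu.
have hS : 0 <= tau t0 ^+ 2 * \sum_j w j (t0, x0) ^+ 2 by rewrite mulr_ge0// ltW.
move: d0; rewrite /dens/= => d0.
have u2 : u (t0, x0) ^+ 2 = 0 by lra.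
have v2 : v (t0, x0) ^+ 2 = 0 by lra.
have S2 : tau t0 ^+ 2 * \sum_j w j (t0, x0) ^+ 2 = 0 by lra.
split.
- by apply/eqP; rewrite -sqrf_eq0 u2.
- by apply/eqP; rewrite -sqrf_eq0 v2.
move=> j; apply/eqP; rewrite -sqrf_eq0; apply/eqP.
move/eqP: S2; rewrite mulf_eq0 (gt_eqF tau0)/= psumr_eq0; last first.
  by move=> i _; rewrite sqr_ge0.
by move=> /allP/(_ j); rewrite mem_index_enum => /(_ erefl)/eqP.
Qed.

End Cone.

Lemma finite_speed t x : 1 <= t -> t < b -> (phase alpha t + r) ^+ 2 < sqn x ->
  [/\ u (t, x) = 0, v (t, x) = 0 & forall j, w j (t, x) = 0].
Proof.
rewrite le_eqVlt => /predU1P[<-|t1] tb.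
  by rewrite phase1 add0r; exact: initial_support.
move=> H.
have ph := phase_ge0 a1 (ltW t1).
have q0 : 0 < phase alpha t + r by rewrite ltr_wpDl.
pose m := Num.sqrt (sqn x).
have mE : m ^+ 2 = sqn x by rewrite sqr_sqrtr// sqn_ge0.
have qm : phase alpha t + r < m.
  by rewrite -ltr_sqr ?nnegrE ?mE// ?sqrtr_ge0// ltW.
(* Any radius strictly between phase alpha t and sqrt (sqn x) - r. *)
pose rho0 := (phase alpha t + (m - r)) / 2.
apply: (@cone_vanishing t rho0 x) => //; first by rewrite /rho0; lra.
by rewrite -mE ltr_sqr ?nnegrE /rho0; lra.
Qed.

End FiniteSpeed.
(** * Blow-up of ordinary differential inequalities *)

Section RealInequalities.
Context {R : realType}.
Implicit Types (a p t s x y : R).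

Lemma powRDp t x y : 0 < t -> t `^ (x + y) = t `^ x * t `^ y.
Proof. by move=> t0; rewrite powRD// implybE (gt_eqF t0) orbT. Qed.

Lemma powR_succ t x : 0 < t -> t `^ (x - 1) = t `^ x / t.
Proof. by move=> t0; rewrite powRDp// powR_inv1// ltW. Qed.

Lemma powR_ge1 t x : 1 <= t -> 0 <= x -> 1 <= t `^ x.
Proof. by move=> t1 x0; rewrite -(powRr0 t) ler_powR. Qed.

Lemma ler_nneg_powR x y p : p <= 0 -> 0 < x -> x <= y -> y `^ p <= x `^ p.
Proof.
move=> p0 x0 xy; rewrite -[p]opprK powRN [leRHS]powRN.
have y0 : 0 < y by exact: lt_le_trans xy.
rewrite lef_pV2 ?posrE ?powR_gt0// ge0_ler_powR// ?nnegrE ?oppr_ge0// ltW//.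
Qed.

(** A power function lies above its tangents (a form of Young's inequality); integrated
    in [rV_int_holder] with an optimal [s], it gives Hoelder's inequality. *)
Lemma tangent_powR p a s : 1 < p -> 0 <= a -> 0 < s ->
  p * s `^ (p - 1) * a - (p - 1) * s `^ p <= a `^ p.
Proof.
move=> p1 a0 s0; have p0 : 0 < p by lra.
have p10 : 0 < p - 1 by lra.
have q0 : 0 < p / (p - 1) by rewrite divr_gt0.
have := @conjugate_powR R a (s `^ (p - 1)) p (p / (p - 1)) a0 (powR_ge0 _ _) p0 q0.
have -> : p^-1 + (p / (p - 1))^-1 = 1 by field; rewrite !gt_eqF.
move=> /(_ erefl); rewrite -powRrM.
have -> : (p - 1) * (p / (p - 1)) = p by field; rewrite gt_eqF.
rewrite -(ler_pM2l p0) => H.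
have E : p * (a `^ p / p + s `^ p / (p / (p - 1))) = a `^ p + (p - 1) * s `^ p.
  by field; rewrite !gt_eqF.
rewrite E in H; lra.
Qed.

Lemma ler_from_derivative (f df : R -> R) (x y : R) : x <= y ->
  (forall t, x <= t <= y -> {for t, continuous f}) ->
  (forall t, x < t < y -> is_derive t 1 f (df t)) ->
  (forall t, x < t < y -> 0 <= df t) -> f x <= f y.
Proof.
move=> xy cf fdf df0.
apply: (@ger0_derive1_le_cc R f x y); rewrite ?in_itv/= ?lexx ?xy//.
- by move=> t; rewrite in_itv/= => /fdf[].
- move=> t; rewrite in_itv/= => tI; have [_ D] := fdf t tI.
  by rewrite derive1E D df0.
- by apply: continuous_in_subspaceT => t; rewrite inE/= in_itv/=; exact: cf.
Qed.

(** Continuous induction: the infimum of the times where [f] is not positive would be a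
    counterexample to the last hypothesis. *)
Lemma positivity_continuation (f : R -> R) (x y : R) :
  (forall t, x <= t <= y -> {for t, continuous f}) -> 0 < f x ->
  (forall t, x < t <= y -> (forall s, x <= s < t -> 0 < f s) -> 0 < f t) ->
  forall t, x <= t <= y -> 0 < f t.
Proof.
move=> cf fx step t tI; rewrite ltNge; apply/negP => ft.
pose Z := [set s | x <= s <= y /\ f s <= 0].
have Zt : Z t by [].
have lbZ : lbound Z x by move=> s [/andP[]].
have infZ : has_inf Z by split; [exists t|exists x].
have xI : x <= inf Z by apply: lb_le_inf => //; exists t.
have Iy : inf Z <= y.
  by rewrite (le_trans (ge_inf _ Zt))//; [exists x|have /andP[] := tI].
have below s : x <= s < inf Z -> 0 < f s.
  move=> /andP[xs sI]; rewrite ltNge; apply/negP => fs.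
  have : inf Z <= s.
    apply: ge_inf; first by exists x.
    by split=> //; rewrite xs (le_trans (ltW sI)).
  by rewrite leNgt sI.
have fI : 0 < f (inf Z).
  have [<-//|xI'] := eqVneq x (inf Z).
  by apply: step => //; rewrite lt_neqAle xI' xI.
have C : {for inf Z, continuous f} by apply: cf; rewrite xI.
have /nbhs_ballP[e /= e0 He] : \forall s \near inf Z, 0 < f s.
  exact: (cvgr_gt _ C).
have [z [zI fz] zI'] := inf_adherent e0 infZ.
have zb : ball (inf Z) e z.
  have : inf Z <= z by apply: ge_inf; [exists x|split].
  by rewrite -ball_normE/= => h; rewrite ltr_norml; lra.
by have := He z zb; rewrite /= ltNge fz.
Qed.

(** Along the flow the nonnegative quantity [Q `^ (1 - p)] decreases at least at the rate
    [(p - 1) * k * t `^ (- g)]. *)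
Lemma blowup_inequality (Q dQ Phi : R -> R) (t0 k g p : R) :
  1 < t0 -> 1 < p -> 0 < k ->
  (forall t, 1 <= t <= t0 -> {for t, continuous Q}) ->
  (forall t : R, 1 < t < t0 -> is_derive t 1 Q (dQ t)) ->
  (forall t, 1 <= t <= t0 -> 0 < Q t) ->
  (forall t, 1 < t < t0 -> k * t `^ (- g) * Q t `^ p <= dQ t) ->
  (forall t : R, 0 < t -> is_derive t 1 Phi (t `^ (- g))) ->
  (p - 1) * k * (Phi t0 - Phi 1) <= Q 1 `^ (1 - p).
Proof.
move=> t01 p1 k0 cQ QdQ Q0 rate dPhi.
pose Y t := - (Q t `^ (1 - p)) - (p - 1) * k * Phi t.
suff : Y 1 <= Y t0.
  rewrite /Y => H; have := powR_ge0 (Q t0) (1 - p); lra.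
have dPow t : 1 <= t <= t0 -> is_derive (Q t) 1 (fun q : R => q `^ (1 - p))
    ((1 - p) * Q t `^ (1 - p - 1)).
  by move=> /Q0 q0; exact: is_derive1_powR.
apply: (@ler_from_derivative Y (fun t => (p - 1) * Q t `^ (1 - p - 1) * dQ t
    - (p - 1) * k * t `^ (- g))) => [|t tI|t tI|t tI].
- exact: ltW.
- have tp : 0 < t by have /andP[] := tI; lra.
  apply: contB.
    apply: contN; apply: (@cont_comp R R Q (fun q => q `^ (1 - p))).
      exact: cQ.
    exact: drv_cont (dPow t tI).
  by apply: contM; [exact: cont_cst|exact: drv_cont (dPhi t tp)].
- have /andP[t1 tt0] := tI; have tp : 0 < t by lra.
  have tI' : 1 <= t <= t0 by rewrite !ltW.
  have H1 := drv_comp (QdQ t tI) (dPow t tI').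
  have H2 := drvM (drv_cst ((p - 1) * k) t 1) (dPhi t tp).
  have H3 := drvB (drvB (drv_cst 0 t 1) H1) H2.
  rewrite /Y; under eq_fun do rewrite -[- _ `^ _]sub0r.
  apply: (is_derive_eq H3); ring.
have /andP[t1 tt0] := tI; have tp : 0 < t by lra.
have q0 : 0 < Q t by apply: Q0; rewrite !ltW.
rewrite subr_ge0 -!mulrA ler_pM2l ?subr_gt0//.
have qp : 0 < Q t `^ p by rewrite powR_gt0.
have -> : Q t `^ (1 - p - 1) = (Q t `^ p)^-1 by rewrite -powRN; congr (_ `^ _); ring.
by rewrite [leRHS]mulrC ler_pdivlMr//; exact: rate.
Qed.

End RealInequalities.

Section Systems.
Context {R : realType}.
Variables (alpha mu p t0 : R).
Hypotheses (a0 : 0 <= alpha) (a1 : alpha < 1) (mu0 : 0 <= mu) (p1 : 1 < p).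
Hypothesis t01 : 1 < t0.
Variables (V G : R -> R).
Hypothesis cV : forall t, 1 <= t <= t0 -> {for t, continuous V}.
Hypothesis G0 : forall t, 1 < t < t0 -> 0 <= G t.

Let cont_powR (x t : R) : 0 < t -> {for t, continuous (fun t : R => t `^ x)}.
Proof. by move=> tp; exact: drv_cont (is_derive1_powR x tp). Qed.

(** With the integrating factor [t `^ mu] the linear part disappears. *)
Lemma damped_system_blowup (C m : R) (Phi : R -> R) : 0 < C ->
  (forall t : R, 1 < t < t0 -> is_derive t 1 V (- (mu / t) * V t + G t)) ->
  0 < V 1 ->
  (forall t, 1 < t < t0 -> 0 < V t ->
     V t `^ p * (C * t `^ m) `^ (1 - p) <= G t) ->
  (forall t : R, 0 < t -> is_derive t 1 Phi (t `^ (- ((p - 1) * (mu + m))))) ->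
  (p - 1) * C `^ (1 - p) * (Phi t0 - Phi 1) <= V 1 `^ (1 - p).
Proof.
move=> C0 dV V1 VG dPhi.
pose Q t := t `^ mu * V t.
have Q1 : Q 1 = V 1 by rewrite /Q powR1 mul1r.
have cQ t : 1 <= t <= t0 -> {for t, continuous Q}.
  move=> tI; apply: contM; last exact: cV.
  by apply: cont_powR; have /andP[] := tI; lra.
have dQ t : 1 < t < t0 -> is_derive t 1 Q (t `^ mu * G t).
  move=> tI; have tp : 0 < t by have /andP[] := tI; lra.
  apply: (is_derive_eq (drvM (is_derive1_powR mu tp) (dV t tI))).
  by rewrite powR_succ//; field; rewrite gt_eqF.
have Qge t : 1 <= t <= t0 -> V 1 <= Q t.
  move=> /andP[t1 tt0]; rewrite -Q1.
  apply: (@ler_from_derivative R Q (fun t => t `^ mu * G t)) => // s /andP[s1 st].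
  - by apply: cQ; rewrite s1 (le_trans st).
  - by apply: dQ; rewrite s1 (lt_le_trans st).
  - by rewrite mulr_ge0 ?powR_ge0// G0// s1 (lt_le_trans st).
have Qpos t : 1 <= t <= t0 -> 0 < Q t by move=> /Qge; exact: lt_le_trans.
rewrite -Q1; apply: (@blowup_inequality R Q (fun t => t `^ mu * G t) Phi t0
  (C `^ (1 - p)) ((p - 1) * (mu + m)) p) => // [|t tI]; first by rewrite powR_gt0.
have /andP[t1 tt0] := tI; have tp : 0 < t by lra.
have tmu : 0 < t `^ mu by rewrite powR_gt0.
have VE : V t = t `^ (- mu) * Q t by rewrite /Q powRN mulKf// gt_eqF.
have Vp : 0 < V t.
  by rewrite VE mulr_gt0 ?powR_gt0// Qpos// !ltW.
have Q0 : 0 <= Q t by rewrite ltW// Qpos// !ltW.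
apply: (@le_trans _ _ (t `^ mu * (V t `^ p * (C * t `^ m) `^ (1 - p)))); last first.
  by rewrite ler_wpM2l ?powR_ge0// VG.
rewrite {1}VE powRM ?powR_ge0// powRM ?powR_ge0 ?(ltW C0)// -!powRrM.
have -> : - ((p - 1) * (mu + m)) = mu + (- mu * p + m * (1 - p)) by ring.
rewrite !(powRDp _ _ tp); lra.
Qed.

Variable F : R -> R.
Hypothesis cF : forall t, 1 <= t <= t0 -> {for t, continuous F}.
Hypothesis dF : forall t : R, 1 < t < t0 -> is_derive t 1 F (V t).
Hypothesis dV : forall t, 1 < t < t0 ->
  is_derive t 1 V ((t `^ (- alpha)) ^+ 2 * F t - mu / t * V t + G t).
Hypotheses (F1 : 0 < F 1) (V1 : F 1 <= V 1).

Let V1p : 0 < V 1. Proof. exact: lt_le_trans V1. Qed.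

Let F_ge t : 1 <= t <= t0 -> (forall s, 1 <= s < t -> 0 < V s) -> F 1 <= F t.
Proof.
move=> /andP[t1 tt0] H.
apply: (@ler_from_derivative R F V) => // s /andP[s1 st].
- by apply: cF; rewrite s1 (le_trans st).
- by apply: dF; rewrite s1 (lt_le_trans st).
- by apply/ltW/H; rewrite st ltW.
Qed.

Lemma wave_system_pos t : 1 <= t <= t0 -> 0 < V t.
Proof.
move: t; apply: positivity_continuation => // t /andP[t1 tt0] H.
pose X s := s `^ mu * V s.
have X1 : X 1 <= X t.
  apply: (@ler_from_derivative R X (fun s => s `^ mu *
    ((s `^ (- alpha)) ^+ 2 * F s + G s))) => [|s /andP[s1 st]|s /andP[s1 st]|s /andP[s1 st]].
  - exact: ltW.
  - apply: contM; first by apply: cont_powR; lra.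
    by apply: cV; rewrite s1 (le_trans st).
  - have sp : 0 < s by lra.
    have sI : 1 < s < t0 by rewrite s1 (lt_le_trans st).
    apply: (is_derive_eq (drvM (is_derive1_powR mu sp) (dV sI))).
    by rewrite powR_succ//; field; rewrite gt_eqF.
  - have sI : 1 < s < t0 by rewrite s1 (lt_le_trans st).
    rewrite mulr_ge0 ?powR_ge0// addr_ge0 ?G0// mulr_ge0 ?sqr_ge0//.
    apply: ltW; apply: (lt_le_trans F1); apply: F_ge; first by rewrite !ltW//; case/andP: sI.
    by move=> q /andP[q1 qs]; apply: H; rewrite q1 (lt_trans qs).
have tmu : 0 < t `^ mu by rewrite powR_gt0//; lra.
rewrite -(pmulr_rgt0 _ tmu); apply: (lt_le_trans _ X1).
by rewrite /X powR1 mul1r.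
Qed.

Let F_pos t : 1 <= t <= t0 -> 0 < F t.
Proof.
move=> tI; apply: (lt_le_trans F1); apply: F_ge => // s /andP[s1 st].
have /andP[_ tt0] := tI.
by apply: wave_system_pos; rewrite s1 (le_trans (ltW st)).
Qed.

Let powR_inv_le t : 1 <= t -> t^-1 <= t `^ (- alpha).
Proof.
move=> t1; rewrite -powR_inv1; last by lra.
by rewrite ler_powR// lerN2 ltW.
Qed.

(** [V - m t^(-alpha) F] has a nonnegative forcing, since F > 0, as soon as
    [m ^+ 2 + m * mu <= 1], for which [m = (2 + mu)^-1] is a convenient choice; it starts nonnegative
    because [V 1 >= F 1]. *)
Lemma wave_system_slope t : 1 <= t <= t0 ->
  (2 + mu)^-1 * t `^ (- alpha) * F t <= V t.
Proof.
move=> /andP[t1 tt0]; pose m := (2 + mu)^-1.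
have m2 : 0 < 2 + mu by rewrite ltr_wpDr.
have m0 : 0 < m by rewrite invr_gt0.
have m1 : m * (2 + mu) = 1 by rewrite mulVf// gt_eqF.
pose X s := V s - m * s `^ (- alpha) * F s.
pose Y s := s `^ mu * expR (m * phase alpha s) * X s.
have : Y 1 <= Y t.
  apply: (@ler_from_derivative R Y (fun s => s `^ mu * expR (m * phase alpha s) *
     (G s + F s * ((s `^ (- alpha)) ^+ 2 * (1 - m ^+ 2)
        - m * (mu - alpha) * s^-1 * s `^ (- alpha)))))
     => // s /andP[s1 st]; have sp : 0 < s by lra.
  - have sI : 1 <= s <= t0 by rewrite s1 (le_trans st).
    apply: contM; last first.
      apply: contB; first exact: cV.
      apply: contM; last exact: cF.
      by apply: contM; [exact: cont_cst|exact: cont_powR].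
    apply: contM; first exact: cont_powR.
    apply: (@cont_comp R R _ expR); last exact: continuous_expR.
    by apply: contM; [exact: cont_cst|exact: drv_cont (drv_phase a1 sp)].
  - have sI : 1 < s < t0 by rewrite s1 (lt_le_trans st).
    have E1 := drvM (drv_cst m s 1) (drv_phase a1 sp).
    have E2 := drv_comp E1 (is_derive_expR _).
    have E3 := drvM (is_derive1_powR mu sp) E2.
    have E4 := drvM (drv_cst m s 1) (is_derive1_powR (- alpha) sp).
    have E5 := drvB (dV sI) (drvM E4 (dF sI)).
    apply: (is_derive_eq (drvM E3 E5)).
    rewrite !powR_succ// /X; field; rewrite gt_eqF//.
  - have sI : 1 < s < t0 by rewrite s1 (lt_le_trans st).
    have sI' : 1 <= s <= t0 by case/andP: sI => *; rewrite !ltW.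
    rewrite mulr_ge0 ?mulr_ge0 ?powR_ge0 ?expR_ge0// addr_ge0 ?G0//.
    rewrite mulr_ge0 ?(ltW (F_pos sI'))//.
    have := powR_inv_le (ltW s1); set tau := s `^ _ => h.
    have tau0 : 0 < tau by rewrite powR_gt0.
    have i0 : 0 < s^-1 by rewrite invr_gt0.
    have h1 : m * (mu - alpha) * s^-1 * tau <= m * mu * tau * tau.
      apply: ler_wpM2r; first exact: ltW.
      apply: (@le_trans _ _ (m * mu * s^-1)).
        by rewrite ler_wpM2r// ?(ltW i0)// ler_wpM2l ?(ltW m0)// gerBl.
      by rewrite ler_wpM2l// mulr_ge0// ltW.
    have h2 : 0 <= tau ^+ 2 * (1 - m ^+ 2 - m * mu).
      rewrite mulr_ge0 ?sqr_ge0//; have := mu0; nra.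
    lra.
rewrite /Y powR1 phase1 mulr0 expR0 !mul1r => H.
have X1 : 0 <= X 1.
  rewrite /X powR1 mulr1 subr_ge0; have := mu0; have := F1; have := V1; nra.
have : 0 <= t `^ mu * expR (m * phase alpha t) * X t by exact: le_trans H.
rewrite pmulr_rge0 ?subr_ge0// mulr_gt0 ?expR_gt0// powR_gt0//; lra.
Qed.

Let am := (alpha + mu) / 2.
(** [lam] is the approximate decaying solution t^((alpha+mu)/2) exp(-A(t)) of the
    adjoint equation, times a bounded correction: the last term of the
    exponent contributes [t `^ (alpha - 2) / 4] to the logarithmic derivative,
    which absorbs the error of order t^-2 of the approximation.  [beta] is
    [mu / t - lam' / lam]. *)
Let lam t := t `^ am * expR (- phase alpha t - (4 * (1 - alpha))^-1 * t `^ (alpha - 1)).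
Let beta t := (mu - am) / t + t `^ (- alpha) - t `^ (alpha - 2) / 4.
Let Q t := lam t * (V t + beta t * F t).

Let a1n : 1 - alpha != 0. Proof. by rewrite gt_eqF// subr_gt0. Qed.

Let lam_gt0 t : 0 < t -> 0 < lam t.
Proof. by move=> tp; rewrite mulr_gt0 ?expR_gt0// powR_gt0. Qed.

Let dlam (t : R) : 0 < t -> is_derive t 1 lam (lam t * (mu / t - beta t)).
Proof.
move=> tp.
have E1 := drvM (drv_cst (4 * (1 - alpha))^-1 t 1) (is_derive1_powR (alpha - 1) tp).
have E2 := drvB (drvB (drv_cst 0 t 1) (drv_phase a1 tp)) E1.
have E3 := drvM (is_derive1_powR am tp) (drv_comp E2 (is_derive_expR _)).
rewrite /lam; under eq_fun do rewrite -[- phase _ _]sub0r.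
apply: (is_derive_eq E3).
rewrite /lam /beta powR_succ// sub0r.
rewrite (_ : alpha - 1 - 1 = alpha - 2); last by ring.
set x := t `^ (alpha - 2); set y := t `^ (alpha - 1).
by field; rewrite gt_eqF// a1n.
Qed.

Let dbeta (t : R) : 0 < t -> is_derive t 1 beta
  (- (mu - am) / t ^+ 2 - alpha * t `^ (- alpha) / t
   + (2 - alpha) * t `^ (alpha - 2) / t / 4).
Proof.
move=> tp.
have E0 : is_derive t 1 (fun t : R => t^-1) (- t ^- 2).
  have t0' : t != 0 by rewrite gt_eqF.
  by apply: (is_derive_eq (is_deriveV t0' _)); rewrite /GRing.scale/= mulr1.
have E1 := drvM (drv_cst (mu - am) t 1) E0.
have E2 := is_derive1_powR (- alpha) tp.
have E3 := drvM (is_derive1_powR (alpha - 2) tp) (drv_cst 4^-1 t 1).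
apply: (is_derive_eq (drvB (drvD E1 E2) E3)).
by rewrite !powR_succ//; field; rewrite gt_eqF.
Qed.

(** The subsolution property, already valid at time 1.  The error of the
    approximation is [(am - 1) * (mu - am) >= - 1/4] times t^-2, and the
    correction contributes at least [1/2 - 1/16] times t^-2. *)
Let weight_subsolution t : 1 <= t ->
  0 <= (t `^ (- alpha)) ^+ 2 + (mu / t - beta t) * beta t
  + (- (mu - am) / t ^+ 2 - alpha * t `^ (- alpha) / t
     + (2 - alpha) * t `^ (alpha - 2) / t / 4).
Proof.
move=> t1; have tp : 0 < t by lra.
have i0 : 0 < t^-1 by rewrite invr_gt0.
have E : t `^ (- alpha) * t `^ (alpha - 2) = t^-1 ^+ 2.
  rewrite -powRDp// (_ : - alpha + (alpha - 2) = (-1) + (-1)); last by ring.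
  by rewrite powRDp// powR_inv1 ?expr2// ltW.
have th0 : 0 <= t `^ (alpha - 2) by exact: powR_ge0.
have th1 : t `^ (alpha - 2) <= t^-1.
  rewrite -powR_inv1; last exact: ltW.
  by rewrite ler_powR//; have := a1; lra.
rewrite /beta -exprVn.
move: E th0 th1; set tau := t `^ (- alpha); set th := t `^ (alpha - 2).
set i := t^-1 in i0 * => E th0 th1.
have -> : tau ^+ 2 + (mu * i - ((mu - am) * i + tau - th / 4)) *
   ((mu - am) * i + tau - th / 4)
   + (- (mu - am) * i ^+ 2 - alpha * tau * i + (2 - alpha) * th * i / 4)
  = i ^+ 2 * ((am - 1) * (mu - am)) + (tau * th) / 2 - th ^+ 2 / 16
    + i * th * (2 - 2 * alpha) / 4 by rewrite /am; field.
rewrite E.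
have h1 : th ^+ 2 <= i ^+ 2 by rewrite ler_sqr ?nnegrE// ltW.
have h2 : - 4^-1 <= (am - 1) * (mu - am).
  have : (am - 1) * (mu - am) = ((mu - 1) ^+ 2 - (1 - alpha) ^+ 2) / 4.
    by rewrite /am; field.
  have := sqr_ge0 (mu - 1); have := a0; have := a1; nra.
have h3 : 0 <= i * th * (2 - 2 * alpha) / 4.
  by rewrite !mulr_ge0// ?(ltW i0)//; have := a1; lra.
have h4 : i ^+ 2 * (- 4^-1) <= i ^+ 2 * ((am - 1) * (mu - am)).
  by rewrite ler_wpM2l// sqr_ge0.
have := sqr_ge0 i; lra.
Qed.

(** [Q = lam (V + beta F)] satisfies [Q' >= lam G], and is at most a multiple of [lam V]
    by [wave_system_slope]; the factor [exp(phase)] of the volume is compensated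
    by [lam]. *)
Lemma wave_system_blowup (C m : R) (Phi : R -> R) : 0 < C ->
  (forall t, 1 < t < t0 -> 0 < V t ->
     V t `^ p * (C * (expR (phase alpha t) * t `^ m)) `^ (1 - p) <= G t) ->
  (forall t : R, 0 < t -> is_derive t 1 Phi (t `^ (- ((p - 1) * (am + m))))) ->
  (p - 1) * ((1 + (1 + mu) * (2 + mu)) `^ (- p) * C `^ (1 - p)) * (Phi t0 - Phi 1)
  <= (lam 1 * V 1) `^ (1 - p).
Proof.
move=> C0 VG dPhi.
pose dQ t := lam t * (G t + F t * ((t `^ (- alpha)) ^+ 2
  + (mu / t - beta t) * beta t
  + (- (mu - am) / t ^+ 2 - alpha * t `^ (- alpha) / t
     + (2 - alpha) * t `^ (alpha - 2) / t / 4))).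
have QdQ t : 1 < t < t0 -> is_derive t 1 Q (dQ t).
  move=> tI; have tp : 0 < t by have /andP[] := tI; lra.
  have E1 := drvD (dV tI) (drvM (dbeta tp) (dF tI)).
  apply: (is_derive_eq (drvM (dlam tp) E1)).
  rewrite /dQ; move: (lam t) (beta t) (t `^ _) (t `^ _) => l be x y.
  by field; rewrite gt_eqF.
have dQ_ge t : 1 < t < t0 -> lam t * G t <= dQ t.
  move=> tI; have /andP[t1 tt0] := tI; have tp : 0 < t by lra.
  rewrite /dQ ler_wpM2l ?(ltW (lam_gt0 tp))// lerDl mulr_ge0//.
    by rewrite ltW// F_pos// !ltW.
  exact: weight_subsolution (ltW t1).
have cQ t : 1 <= t <= t0 -> {for t, continuous Q}.
  move=> tI; have tp : 0 < t by have /andP[] := tI; lra.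
  apply: contM; first exact: drv_cont (dlam tp).
  apply: contD; first exact: cV.
  by apply: contM; [exact: drv_cont (dbeta tp)|exact: cF].
have Q1 : lam 1 * V 1 <= Q 1.
  rewrite ler_wpM2l ?(ltW (lam_gt0 ltr01))// lerDl mulr_ge0 ?(ltW F1)//.
  rewrite /beta !powR1 /am; have := a1; have := mu0; lra.
have lV1 : 0 < lam 1 * V 1 by rewrite mulr_gt0// lam_gt0.
have Qpos t : 1 <= t <= t0 -> 0 < Q t.
  move=> /andP[t1 tt0]; apply: (lt_le_trans (lt_le_trans lV1 Q1)).
  apply: (@ler_from_derivative R Q dQ) => // s /andP[s1 st].
  - by apply: cQ; rewrite s1 (le_trans st).
  - by apply: QdQ; rewrite s1 (lt_le_trans st).
  - have sI : 1 < s < t0 by rewrite s1 (lt_le_trans st).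
    apply: le_trans (dQ_ge s sI); rewrite mulr_ge0 ?G0//.
    by rewrite ltW// lam_gt0//; lra.
pose C1 := 1 + (1 + mu) * (2 + mu).
have C1p : 0 < C1 by rewrite /C1 ltr_pwDl// mulr_ge0// addr_ge0.
have QV t : 1 <= t <= t0 -> Q t <= C1 * (lam t * V t).
  move=> tI; have /andP[t1 tt0] := tI; have tp : 0 < t by lra.
  rewrite /Q mulrCA ler_wpM2l ?(ltW (lam_gt0 tp))// /C1 [leRHS]mulrDl mul1r lerD2l.
  have Fp := F_pos tI.
  have := wave_system_slope tI; set tau := t `^ (- alpha) => S.
  have tau0 : 0 < tau by rewrite powR_gt0.
  have bt : beta t <= (1 + mu) * tau.
    have h : (mu - am) / t <= mu * tau.
      apply: (@le_trans _ _ (mu * t^-1)).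
        rewrite ler_wpM2r ?invr_ge0 ?(ltW tp)// gerBl /am; have := a0; have := mu0; lra.
      by rewrite ler_wpM2l// powR_inv_le.
    have := powR_ge0 t (alpha - 2); rewrite /beta -/tau; lra.
  apply: (@le_trans _ _ ((1 + mu) * tau * F t)).
    by apply: ler_wpM2r => //; exact: ltW.
  rewrite -!mulrA; apply: ler_wpM2l; first by rewrite addr_ge0.
  have m2 : 0 < 2 + mu by rewrite ltr_wpDr.
  by move: S; rewrite -mulrA ler_pdivrMl.
apply: (@le_trans _ _ (Q 1 `^ (1 - p))); last first.
  by apply: ler_nneg_powR => //; have := p1; lra.
apply: (@blowup_inequality R Q dQ Phi t0 _ ((p - 1) * (am + m)) p) => // [|t tI].
  by rewrite mulr_gt0 ?powR_gt0.
have /andP[t1 tt0] := tI; have tp : 0 < t by lra.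
have tI' : 1 <= t <= t0 by rewrite !ltW.
apply: le_trans (dQ_ge t tI).
have lp := lam_gt0 tp; have Vp := wave_system_pos tI'; have Qp := Qpos t tI'.
apply: (@le_trans _ _ (lam t * (V t `^ p *
    (C * (expR (phase alpha t) * t `^ m)) `^ (1 - p)))); last first.
  by rewrite ler_wpM2l ?(ltW lp)// VG.
have W0 : 0 < C * (expR (phase alpha t) * t `^ m).
  by rewrite !mulr_gt0 ?expR_gt0 ?powR_gt0.
have lamle : lam t * expR (phase alpha t) <= t `^ am.
  rewrite /lam -mulrA -expRD ler_piMr ?powR_ge0// expR_le1.
  rewrite addrAC addNr sub0r oppr_le0 mulr_ge0 ?powR_ge0// invr_ge0 mulr_ge0//.
  by rewrite subr_ge0 ltW.
have E1 : (C1 * (lam t * V t)) `^ p = C1 `^ p * (lam t `^ p * V t `^ p).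
  rewrite powRM ?(ltW C1p)//; last by rewrite mulr_ge0// ltW.
  by rewrite (powRM _ (ltW lp) (ltW Vp)).
have E2 : lam t * V t `^ p = C1 `^ (- p) * (lam t `^ (1 - p) *
    (C1 * (lam t * V t)) `^ p).
  rewrite E1 powRN [lam t `^ (1 - p)]powRDp// powRr1 ?(ltW lp)// powRN.
  have c : C1 `^ p != 0 by rewrite gt_eqF// powR_gt0.
  have l : lam t `^ p != 0 by rewrite gt_eqF// powR_gt0.
  by field; rewrite c l.
set W := (C * (expR (phase alpha t) * t `^ m)) in W0 *.
set Z := (C1 * (lam t * V t)) in E1 E2.
have -> : lam t * (V t `^ p * W `^ (1 - p)) =
    C1 `^ (- p) * (lam t `^ (1 - p) * W `^ (1 - p) * Z `^ p).
  by rewrite mulrA E2; ring.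
rewrite -!(mulrA (C1 `^ (- p))); apply: ler_wpM2l; first exact: powR_ge0.
have p0 : 0 <= p by have := p1; lra.
have key : Q t `^ p <= Z `^ p.
  apply: ge0_ler_powR => //; rewrite ?nnegrE; [exact: ltW| |exact: QV].
  by rewrite /Z mulr_ge0 ?(ltW C1p)// mulr_ge0// ltW.
rewrite -(powRM _ (ltW lp) (ltW W0)).
apply: ler_pM; rewrite ?mulr_ge0 ?powR_ge0//.
have -> : - ((p - 1) * (am + m)) = (am + m) * (1 - p) by ring.
rewrite powRrM -powRM ?powR_ge0 ?(ltW C0)//.
apply: ler_nneg_powR; [by have := p1; lra|by rewrite mulr_gt0|].
have -> : lam t * W = C * ((lam t * expR (phase alpha t)) * t `^ m).
  by rewrite /W; move: (lam t) => l; ring.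
rewrite (powRDp _ _ tp) ler_wpM2l ?(ltW C0)//.
by apply: ler_wpM2r => //; exact: powR_ge0.
Qed.

End Systems.
(** * Hoelder's inequality and weighted volumes of balls *)

Section WeightedIntegrals.
Context {R : realType} {n : nat}.
Implicit Types (f h : 'rV[R]_n -> R) (x : 'rV[R]_n).

Lemma bsuppM f h : bsupp f ->
  (forall M : R, exists B : R, forall x, `|x| <= M -> `|h x| <= B) ->
  bsupp (fun x => f x * h x).
Proof.
move=> [M fM] /(_ M)[B hB].
exists (Num.max M (M * B)) => x; have [fx f0] := fM x.
split; last by rewrite gt_max => /andP[/f0 -> _]; rewrite mul0r.
have M0 : 0 <= M by rewrite (le_trans _ fx).
have [xM|xM] := leP `|x| M; last by rewrite f0// mul0r normr0 le_max M0.
by rewrite le_max normrM ler_pM ?orbT// hB.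
Qed.

Lemma bsupp_powR f (p : R) : 0 < p -> bsupp f -> bsupp (fun x => `|f x| `^ p).
Proof.
move=> p0 [M fM]; exists (Num.max M (M `^ p)) => x; have [fx f0] := fM x.
have M0 : 0 <= M by rewrite (le_trans _ fx).
split; last by rewrite gt_max => /andP[/f0 -> _]; rewrite normr0 powR0// gt_eqF.
by rewrite ger0_norm ?powR_ge0// le_max ge0_ler_powR ?orbT ?nnegrE// ltW.
Qed.

(** [chi] is the indicator of a set that contains the support of [f], and [W] bounds its
    weighted volume. *)
Lemma rV_int_holder (p W : R) (f h chi : 'rV[R]_n -> R) : 1 < p -> 0 < W ->
  bsupp (fun x => f x * h x) -> bsupp (fun x => `|f x| `^ p * h x) ->
  bsupp (fun x => chi x * h x) -> (forall x, 0 <= h x) ->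
  (forall x, chi x = 1 \/ chi x = 0 /\ f x = 0) ->
  rV_int (fun x => chi x * h x) <= W -> 0 < rV_int (fun x => f x * h x) ->
  rV_int (fun x => f x * h x) `^ p * W `^ (1 - p) <= rV_int (fun x => `|f x| `^ p * h x).
Proof.
move=> p1 W0 bf bp bc h0 fchi cW V0; set V := rV_int (fun x => f x * h x) in V0 *.
(* The value of s that makes the tangent bound optimal. *)
pose s := V / W; have s0 : 0 < s by rewrite divr_gt0.
have b1 : bsupp (fun x => p * s `^ (p - 1) * (f x * h x)) by exact: bsuppZ.
have b2 : bsupp (fun x => (p - 1) * s `^ p * (chi x * h x)) by exact: bsuppZ.
have H : rV_int (fun x => p * s `^ (p - 1) * (f x * h x)
    - (p - 1) * s `^ p * (chi x * h x)) <= rV_int (fun x => `|f x| `^ p * h x).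
  apply: rV_int_le => //; first exact: bsuppB.
  move=> x; rewrite !mulrA -mulrBl; apply: ler_wpM2r => //.
  have [->|[-> ->]] := fchi x; last first.
    by rewrite !mulr0 subr0 powR_ge0.
  rewrite mulr1; apply: le_trans (tangent_powR p1 (normr_ge0 (f x)) s0).
  rewrite lerD2r ler_wpM2l ?ler_norm// mulr_ge0 ?powR_ge0//; lra.
rewrite rV_intB// !rV_intZ// -/V in H.
apply: le_trans H.
have sp : s `^ p = s `^ (p - 1) * s.
  by rewrite -{3}(powRr1 (ltW s0)) -powRDp//; congr (_ `^ _); ring.
have sW : s * W = V by rewrite /s divfK// gt_eqF.
have E : V `^ p * W `^ (1 - p) = s `^ (p - 1) * V.
  rewrite -{1}sW (powRM _ (ltW s0) (ltW W0)) -mulrA -powRDp//.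
  have -> : p + (1 - p) = 1 by ring.
  by rewrite powRr1 ?(ltW W0)// sp -mulrA sW.
rewrite E.
have : (p - 1) * s `^ p * rV_int (fun x => chi x * h x) <= (p - 1) * s `^ p * W.
  by rewrite ler_wpM2l// mulr_ge0 ?powR_ge0//; lra.
rewrite [X in _ <= X](_ : _ = (p - 1) * (s `^ (p - 1) * V)); last first.
  by rewrite sp -sW; ring.
lra.
Qed.

Variable i0 : 'I_n.

Definition expw (k : R) x : R := expR (k * x ord0 i0).

Lemma expw_ge0 k x : 0 <= expw k x. Proof. exact: expR_ge0. Qed.

Lemma expw_bounded k (M : R) : exists B : R, forall x, `|x| <= M -> `|expw k x| <= B.
Proof.
exists (expR (`|k| * M)) => x xM; rewrite ger0_norm ?expR_ge0// ler_expR.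
apply: (le_trans (ler_norm _)); rewrite normrM ler_wpM2l//.
exact: le_trans (coord_le_norm _ _) xM.
Qed.

Lemma drv_expw k x j :
  is_derive x (evec j) (expw k) (k * (i0 == j)%:R * expw k x).
Proof.
have E := drvM (drv_cst k x (evec j)) (drv_coord x i0 j).
apply: (is_derive_eq (drv_comp E (is_derive_expR _))).
by rewrite /expw; ring.
Qed.

Lemma cont_expw k (x : 'rV[R]_n) : {for x, continuous (expw k)}.
Proof.
apply: (@cont_comp R _ (fun x : 'rV[R]_n => k * x ord0 i0) expR).
  by apply: contM; [exact: cont_cst|exact: coord_continuous].
exact: continuous_expR.
Qed.

Definition ball_ind (B : R) x : R := (sqn x <= B ^+ 2)%R%:R.

Lemma ball_ind_supp (B : R) x : 0 <= B -> B < `|x| -> ball_ind B x = 0.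
Proof.
move=> B0 xB; rewrite /ball_ind; case: (leP (sqn x) (B ^+ 2)) => // h.
by move: xB; rewrite ltNge norm_le_sqn.
Qed.

Lemma ball_ind_bsupp (B : R) : 0 <= B -> bsupp (ball_ind B).
Proof.
move=> B0; exists (Num.max B 1) => x; split.
  rewrite le_max /ball_ind; apply/orP; right.
  by case: (sqn x <= B ^+ 2); rewrite ?normr1 ?normr0.
by rewrite gt_max => /andP[xB _]; exact: ball_ind_supp.
Qed.

Lemma ball_volume_le (B : R) : 0 <= B ->
  rV_int (fun x => ball_ind B x * expw 0 x) <= (32 * (B + 1)) ^+ n.
Proof.
move=> B0; rewrite -[leRHS]mul1r; apply: (le_trans (ler_norm _)).
apply: rV_int_sup => //; first by lra.
- by apply: bsuppM; [exact: ball_ind_bsupp|exact: expw_bounded].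
- by move=> x xB; rewrite ball_ind_supp ?mul0r//; lra.
- move=> x _; rewrite /expw mul0r expR0 mulr1 /ball_ind.
  by case: (sqn x <= B ^+ 2); rewrite ?normr1 ?normr0.
Qed.

Lemma expR_neg_decay (y : R) : 0 <= y -> expR (- y) <= (1 + y / 2) ^- 2.
Proof.
move=> y0; rewrite expRN lef_pV2 ?posrE ?expR_gt0 ?exprn_gt0//; last by lra.
have -> : expR y = expR (y / 2) ^+ 2.
  by rewrite expr2 -expRD; congr expR; field.
rewrite ler_sqr ?nnegrE ?expR_ge0//; last by lra.
exact: expR_ge1Dx.
Qed.

Lemma gauss_decay (y : R) : expR (- y ^+ 2) <= 4 * (1 + `|y|) ^- 2.
Proof.
apply: (le_trans (expR_neg_decay (sqr_ge0 y))).
have := normr_ge0 y; rewrite -(real_normK (num_real y)); move: `|y| => z z0.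
have -> : 4 / (1 + z) ^+ 2 = (((1 + z) / 2) ^+ 2)^-1.
  by field; rewrite gt_eqF//; lra.
have h1 : 0 < (1 + z) / 2 by lra.
have h2 : (1 + z) / 2 <= 1 + z ^+ 2 / 2 by have := sqr_ge0 (z - 1); nra.
rewrite lef_pV2 ?posrE ?exprn_gt0 ?(lt_le_trans h1)//.
by rewrite ler_sqr ?nnegrE ?(ltW h1)// (le_trans (ltW h1)).
Qed.

(** In the ball, with [y = B - x_1 >= 0], the other coordinates satisfy
    [|x'|^2 <= 2 B y].  Giving up half of the decay of exp(x_1) = exp(B - y) therefore
    yields a Gaussian factor exp(-|x'|^2 / (4 B)), and the weighted volume is that of a
    product of profiles of widths 4 and [2 sqrt B] (n-1 times). *)
Lemma exp_ball_volume_le (B : R) : 0 < B ->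
  rV_int (fun x => ball_ind B x * expw 1 x) <=
  32 * expR B * (64 * Num.sqrt B) ^+ n.-1.
Proof.
move=> B0; pose sB := Num.sqrt B.
have sB0 : 0 < sB by rewrite sqrtr_gt0.
have sBE : sB ^+ 2 = B by rewrite sqr_sqrtr// ltW.
pose c i := if i == i0 then B else 0.
pose s (i : 'I_n) := if i == i0 then 4 else 2 * sB.
have cn (y : R) : \prod_(i < n | i != i0) y = y ^+ n.-1.
  rewrite prodr_const; congr (_ ^+ _).
  have := cardC1 i0; rewrite card_ord => <-.
  by apply: eq_card => i; rewrite !inE.
have prodE : \prod_i (8 * s i) = 8 * 4 * (8 * (2 * sB)) ^+ n.-1.
  rewrite (bigD1 i0)//= {1}/s eqxx (eq_bigr (fun=> 8 * (2 * sB))) ?cn//.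
  by move=> i /negbTE ii0; rewrite /s ii0.
have -> : 32 * expR B * (64 * sB) ^+ n.-1 =
    expR B * 4 ^+ n.-1 * \prod_i (8 * s i).
  rewrite prodE (_ : 64 * sB = 4 * (8 * (2 * sB))); last by ring.
  by rewrite [(4 * _) ^+ _]exprMn; ring.
apply: (@rV_int_decay R n _ _ c).
- by rewrite mulr_ge0 ?expR_ge0.
- by apply: bsuppM; [exact: ball_ind_bsupp (ltW B0)|exact: expw_bounded].
- by move=> i; rewrite /s; case: eqP => _//; rewrite mulr_gt0.
move=> x; rewrite (bigD1 i0)//= /c /s eqxx.
rewrite (eq_bigr (fun i => (1 + `|x ord0 i| / (2 * sB)) ^- 2)); last first.
  by move=> i /negbTE ii0; rewrite ii0 subr0.
have P0 (P : pred 'I_n) : 0 <= \prod_(i | P i) (1 + `|x ord0 i| / (2 * sB)) ^- 2.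
  apply: prodr_ge0 => i _; rewrite invr_ge0 exprn_ge0// addr_ge0// divr_ge0//.
  by rewrite mulr_ge0// ltW.
have f0 : 0 <= (1 + `|x ord0 i0 - B| / 4) ^- 2.
  by rewrite invr_ge0 exprn_ge0// addr_ge0// divr_ge0.
rewrite /ball_ind; case: (leP (sqn x) (B ^+ 2)) => xB; last first.
  by rewrite /= mulr0n mul0r !mulr_ge0// ?expR_ge0.
rewrite /= mulr1n mul1r /expw mul1r.
have xi : `|x ord0 i0| <= B.
  by rewrite (le_trans (coord_le_norm _ _))// norm_le_sqn// ltW.
have /andP[xi1 xi2] : - B <= x ord0 i0 <= B by rewrite -ler_norml.
(* y is the distance to the pole in the direction of the weight. *)
pose y := B - x ord0 i0; have y0 : 0 <= y by rewrite subr_ge0.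
pose q := \sum_(i < n | i != i0) (x ord0 i / (2 * sB)) ^+ 2.
have qy : q <= y / 2.
  have -> : q = (\sum_(i < n | i != i0) x ord0 i ^+ 2) / (4 * B).
    rewrite /q mulr_suml; apply: eq_bigr => i _.
    by rewrite exprMn exprVn exprMn sBE; congr (_ / (_ * _)); ring.
  rewrite ler_pdivrMr ?mulr_gt0//.
  have : sqn x = x ord0 i0 ^+ 2 + \sum_(i < n | i != i0) x ord0 i ^+ 2.
    by rewrite /sqn (bigD1 i0).
  rewrite /y; nra.
apply: (@le_trans _ _ (expR B * expR (- (y / 2)) * expR (- q))).
  by rewrite -!expRD ler_expR /y; move: qy; rewrite /y; lra.
have E1 : expR (- (y / 2)) <= (1 + `|x ord0 i0 - B| / 4) ^- 2.
  have y2 : 0 <= y / 2 by rewrite divr_ge0.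
  rewrite distrC (ger0_norm y0) (_ : y / 4 = y / 2 / 2); last by field.
  exact: expR_neg_decay.
have E2 : expR (- q) <= 4 ^+ n.-1 *
    \prod_(i < n | i != i0) (1 + `|x ord0 i| / (2 * sB)) ^- 2.
  rewrite -cn -big_split/= /q -sumrN expR_sum; apply: ler_prod => i _.
  rewrite expR_ge0/=; apply: (le_trans (gauss_decay _)).
  by rewrite normrM normfV [`|2 * sB|]gtr0_norm// mulr_gt0.
rewrite -!mulrA ler_wpM2l ?expR_ge0// [leRHS]mulrCA.
by apply: ler_pM; rewrite ?expR_ge0.
Qed.

End WeightedIntegrals.
(** * The averaged equation *)

Section Functionals.
Context {R : realType} {n : nat}.
Variables (alpha mu p eps b r : R) (u0 u1 : 'rV[R]_n -> R).
Variables (u v a : R * 'rV[R]_n -> R) (w c d : 'I_n -> R * 'rV[R]_n -> R).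
Hypotheses (a0 : 0 <= alpha) (a1 : alpha < 1) (mu0 : 0 <= mu) (p1 : 1 < p).
Hypotheses (r0 : 0 < r) (b1 : 1 < b).
Hypothesis ws : wave_solution alpha mu p eps b u0 u1 u v a w c d.
Hypothesis supp0 : forall x, r ^+ 2 < sqn x -> u0 x = 0.
Hypothesis supp1 : forall x, r ^+ 2 < sqn x -> u1 x = 0.
Variables (i0 : 'I_n) (k : R).
Implicit Types (x : 'rV[R]_n) (s t : R).

Let om : 'rV[R]_n -> R := expw i0 k.
Let F t := rV_int (fun x => u (t, x) * om x).
Let V t := rV_int (fun x => v (t, x) * om x).
Let G t := rV_int (fun x => `|v (t, x)| `^ p * om x).

(** A bound on the support valid also for the frozen times below 1. *)
Let radius t := phase alpha (Num.max 1 t) + r.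

Let radius_gt0 t : 0 < radius t.
Proof. by rewrite ltr_wpDl// phase_ge0// le_max lexx. Qed.

Let radius_le s t : s <= t -> radius s <= radius t.
Proof.
move=> st; rewrite lerD2r; apply: phase_le => //; first by rewrite le_max ler01.
by rewrite ge_max !le_max lexx st orbT.
Qed.

Let outside t x : radius t < `|x| -> (radius t) ^+ 2 < sqn x.
Proof.
by move=> tx; rewrite ltNge; apply/negP => /(norm_le_sqn (ltW (radius_gt0 t))); rewrite leNgt tx.
Qed.

Let uv_support t x : t < b -> radius t < `|x| -> u (t, x) = 0 /\ v (t, x) = 0.
Proof.
move=> tb /outside tx.
have key s : 1 <= s -> s < b -> (radius s) ^+ 2 < sqn x -> u (s, x) = 0 /\ v (s, x) = 0.
  move=> s1 sb; rewrite /radius (max_idPr s1) => h.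
  by have [] := finite_speed a0 a1 mu0 p1 r0 b1 ws supp0 supp1 s1 sb h.
have [t1|t1] := leP 1 t; first exact: key.
have [-> ->] := ws_past ws x (ltW t1).
by apply: key => //; rewrite /radius maxxx; move: tx; rewrite /radius (max_idPl (ltW t1)).
Qed.

Let w_support t x j : 1 <= t -> t < b -> radius t < `|x| -> w j (t, x) = 0.
Proof.
move=> t1 tb /outside; rewrite /radius (max_idPr t1) => h.
by have [_ _] := finite_speed a0 a1 mu0 p1 r0 b1 ws supp0 supp1 t1 tb h.
Qed.

Let om_cont (z : R * 'rV[R]_n) : {for z, continuous (fun z : R * 'rV[R]_n => om z.2)}.
Proof.
case: z => t x; apply: (@continuous_comp _ _ _ snd om); first exact: cvg_snd.
exact: cont_expw.
Qed.

Let near_support t : t < b -> exists M : R, \forall s \near t,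
  s < b /\ forall x, M < `|x| -> u (s, x) = 0 /\ v (s, x) = 0.
Proof.
move=> tb; exists (radius ((t + b) / 2)).
have tm : t < (t + b) / 2 by lra.
have H : \forall s \near t, s < (t + b) / 2 by exact: lt_nbhsl.
move: H; apply: filterS => s sm; split; first by lra.
by move=> x xM; apply: uv_support; [lra|rewrite (le_lt_trans (radius_le (ltW sm)))].
Qed.

Lemma functional_cont t : t < b ->
  {for t, continuous F} /\ {for t, continuous V}.
Proof.
move=> tb; have [M HM] := near_support tb.
split.
  apply: (@rV_int_continuous R n (fun z => u z * om z.2) t M);
    move: HM; apply: filterS => s [sb H] x.
    by have [cu _ _] := ws_cont ws x sb; apply: contM => //; exact: om_cont.
  by move=> /H[-> _]; rewrite mul0r.
apply: (@rV_int_continuous R n (fun z => v z * om z.2) t M);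
  move: HM; apply: filterS => s [sb H] x.
  by have [_ cv _] := ws_cont ws x sb; apply: contM => //; exact: om_cont.
by move=> /H[_ ->]; rewrite mul0r.
Qed.

Lemma functional_F t : 1 < t -> t < b -> is_derive t 1 F (V t).
Proof.
move=> t1 tb; have [M HM] := near_support tb.
have H1 : \forall s \near t, 1 < s by exact: lt_nbhsr.
apply: (@rV_int_is_derive R n (fun z => u z * om z.2) (fun z => v z * om z.2) t M).
- move: HM; apply: filterS => s [sb H] x.
  by have [cu _ _] := ws_cont ws x sb; apply: contM => //; exact: om_cont.
- move=> x; have [_ cv _] := ws_cont ws x tb.
  by apply: contM => //; exact: om_cont.
- move: H1 HM; apply: filterS2 => s s1 [sb _] x.
  have sI : 1 < s < b by rewrite s1.
  have [du _] := ws_dt ws x sI.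
  apply: (is_derive_eq (drvM du (drv_cst (om x) s 1))).
  by rewrite mulr0 addr0.
- by move: HM; apply: filterS => s [sb H] x /H[-> _]; rewrite mul0r.
Qed.

Let V_drv t : 1 < t -> t < b ->
  is_derive t 1 V (rV_int (fun x => a (t, x) * om x)).
Proof.
move=> t1 tb; have [M HM] := near_support tb.
have H1 : \forall s \near t, 1 < s by exact: lt_nbhsr.
apply: (@rV_int_is_derive R n (fun z => v z * om z.2) (fun z => a z * om z.2) t M).
- move: HM; apply: filterS => s [sb H] x.
  by have [_ cv _] := ws_cont ws x sb; apply: contM => //; exact: om_cont.
- move=> x; have [_ _ ca] := ws_cont ws x tb.
  by apply: contM => //; exact: om_cont.
- move: H1 HM; apply: filterS2 => s s1 [sb _] x.
  have sI : 1 < s < b by rewrite s1.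
  have [_ dv] := ws_dt ws x sI.
  apply: (is_derive_eq (drvM dv (drv_cst (om x) s 1))).
  by rewrite mulr0 addr0.
- by move: HM; apply: filterS => s [sb H] x /H[_ ->]; rewrite mul0r.
Qed.

Let u_bsupp t : t < b -> bsupp (fun x => u (t, x)).
Proof.
move=> tb; apply: (@continuous_bsupp R n _ (radius t)).
  by apply: slice_continuous => x; have [] := ws_cont ws x tb.
by move=> x /(uv_support tb)[].
Qed.

Let v_bsupp t : t < b -> bsupp (fun x => v (t, x)).
Proof.
move=> tb; apply: (@continuous_bsupp R n _ (radius t)).
  by apply: slice_continuous => x; have [] := ws_cont ws x tb.
by move=> x /(uv_support tb)[].
Qed.

Let c_bsupp j t : 1 <= t -> t < b -> bsupp (fun x => c j (t, x)).
Proof.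
move=> t1 tb; apply: (@continuous_bsupp R n _ (radius t)).
  by apply: slice_continuous => x; have [] := ws_contj ws x j tb.
apply: (@partial_support R n (fun x => w j (t, x)) _ j).
  by move=> x; have [] := ws_dx ws x j tb.
by move=> x; exact: w_support.
Qed.

Let om_mul f : bsupp f -> bsupp (fun x => f x * om x).
Proof. by move=> bf; apply: bsuppM => //; exact: expw_bounded. Qed.

Let vp_bsupp t : t < b -> bsupp (fun x => `|v (t, x)| `^ p * om x).
Proof.
move=> tb; apply: om_mul; apply: bsupp_powR; last exact: v_bsupp.
by have := p1; lra.
Qed.

(** Two integrations by parts at once: the integrand minus its expected value is the
    derivative of [w j * om - u * d_j om]. *)
Let laplacian_int j t : 1 <= t -> t < b ->
  rV_int (fun x => c j (t, x) * om x) = k ^+ 2 * (i0 == j)%:R * F t.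
Proof.
move=> t1 tb; set e : R := (i0 == j)%:R.
have ee : e ^+ 2 = e by rewrite /e; case: (i0 == j); rewrite ?expr1n ?expr0n.
have bc := om_mul (c_bsupp j t1 tb); have bu := om_mul (u_bsupp tb).
have : rV_int (fun x => c j (t, x) * om x - k ^+ 2 * e * (u (t, x) * om x)) = 0.
  apply: (@rV_int_partial0 R n
    (fun x => (w j (t, x) - k * e * u (t, x)) * om x) _ j (radius t)).
  - move=> x; have [du _ dw] := ws_dx ws x j tb.
    have E := drvB dw (drvM (drv_cst (k * e) x (evec j)) du).
    apply: (is_derive_eq (drvM E (drv_expw i0 k x j))).
    rewrite -/om -/e -[X in _ - X * (_ * _)]mulr1.
    rewrite -[in RHS]ee; ring.
  - apply: (@slice_continuous R n (fun z => c j z * om z.2 -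
      k ^+ 2 * e * (u z * om z.2))) => x.
    have [_ cc _] := ws_contj ws x j tb; have [cu _ _] := ws_cont ws x tb.
    apply: contB; first by apply: contM => //; exact: om_cont.
    by apply: contM; [exact: cont_cst|apply: contM => //; exact: om_cont].
  - move=> x xr; rewrite w_support//; have [-> _] := uv_support tb xr.
    by rewrite mulr0 subrr mul0r.
rewrite rV_intB//; last exact: bsuppZ.
by rewrite rV_intZ// => /eqP; rewrite subr_eq0 => /eqP.
Qed.

Lemma functional_V t : 1 < t -> t < b ->
  is_derive t 1 V ((t `^ (- alpha)) ^+ 2 * (k ^+ 2 * F t) - mu / t * V t + G t).
Proof.
move=> t1 tb; apply: (is_derive_eq (V_drv t1 tb)).
have tp : 0 < t by lra.
have tI : 1 < t < b by rewrite t1.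
have powE : (t `^ (2 * alpha))^-1 = (t `^ (- alpha)) ^+ 2.
  by rewrite -powRN expr2 -powRDp//; congr (t `^ _); ring.
have bc j := om_mul (c_bsupp j (ltW t1) tb); have bv := om_mul (v_bsupp tb).
have E : (fun x => a (t, x) * om x) = (fun x =>
    ((t `^ (- alpha)) ^+ 2 * (\sum_j c j (t, x) * om x)
     - mu / t * (v (t, x) * om x)) + `|v (t, x)| `^ p * om x).
  by apply/funext => x; rewrite (ws_eq ws x tI) powE -mulr_suml; ring.
have bs : bsupp (fun x => \sum_j c j (t, x) * om x) by exact: bsupp_sum.
rewrite E (@rV_intD R n (fun x => (t `^ (- alpha)) ^+ 2 *
  (\sum_j c j (t, x) * om x) - mu / t * (v (t, x) * om x))); first last.
- exact: vp_bsupp.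
- by apply: bsuppB; exact: bsuppZ.
rewrite rV_intB ?rV_intZ//; try exact: bsuppZ.
rewrite rV_int_sum//; congr (_ * _ - _ + _).
rewrite (eq_bigr (fun j => k ^+ 2 * (i0 == j)%:R * F t)); last first.
  by move=> j _; apply: laplacian_int => //; exact: ltW.
rewrite (bigD1 i0)//= eqxx mulr1 big1 ?addr0// => j /negbTE.
by rewrite eq_sym => ->; rewrite mulr0 mul0r.
Qed.

Lemma functional_G_ge0 t : t < b -> 0 <= G t.
Proof.
move=> tb; apply: rV_int_ge0; first exact: vp_bsupp.
by move=> x; rewrite mulr_ge0 ?powR_ge0// expw_ge0.
Qed.

Lemma functional_holder t (W : R) : 1 <= t -> t < b -> 0 < W -> 0 < V t ->
  rV_int (fun x => ball_ind (phase alpha t + r) x * om x) <= W ->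
  V t `^ p * W `^ (1 - p) <= G t.
Proof.
move=> t1 tb W0 V0 HW.
apply: (@rV_int_holder R n p W (fun x => v (t, x)) om (ball_ind (phase alpha t + r))) => //.
- exact: om_mul (v_bsupp tb).
- exact: vp_bsupp.
- apply: om_mul; apply: ball_ind_bsupp.
  by rewrite ltW// -(max_idPr t1); exact: radius_gt0.
- by move=> x; exact: expw_ge0.
move=> x; rewrite /ball_ind.
case: (leP (sqn x) ((phase alpha t + r) ^+ 2)) => h; [by left|right; split=> //].
by have [] := finite_speed a0 a1 mu0 p1 r0 b1 ws supp0 supp1 t1 tb h.
Qed.

End Functionals.

Section BlowUp.
Context {R : realType} {n : nat}.
Variables (alpha mu p r : R) (u0 u1 : 'rV[R]_n -> R) (i0 : 'I_n).
Hypotheses (a0 : 0 <= alpha) (a1 : alpha < 1) (mu0 : 0 <= mu) (p1 : 1 < p).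
Hypothesis r0 : 0 < r.
Hypothesis supp0 : forall x, r ^+ 2 < sqn x -> u0 x = 0.
Hypothesis supp1 : forall x, r ^+ 2 < sqn x -> u1 x = 0.
Hypotheses (cu0 : continuous u0) (cu1 : continuous u1).
Hypotheses (u0_nt : exists x, u0 x != 0) (u1_nt : exists x, u1 x != 0).
Hypothesis u01 : forall x, 0 <= u0 x <= u1 x.

Let om k : 'rV[R]_n -> R := expw i0 k.

Let data_bsupp (f : 'rV[R]_n -> R) k : continuous f ->
  (forall x, r ^+ 2 < sqn x -> f x = 0) -> bsupp (fun x => f x * om k x).
Proof.
move=> cf f0; apply: bsuppM; last exact: expw_bounded.
apply: (@continuous_bsupp R n _ r) => // x rx; apply: f0.
rewrite ltNge; apply/negP => h.
by move: rx; rewrite ltNge (norm_le_sqn (ltW r0) h).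
Qed.

Let data_pos (f : 'rV[R]_n -> R) k : continuous f ->
  (forall x, r ^+ 2 < sqn x -> f x = 0) -> (exists x, f x != 0) ->
  (forall x, 0 <= f x) -> 0 < rV_int (fun x => f x * om k x).
Proof.
move=> cf supp [x fx] f0; apply: (@rV_int_gt0 R n _ x).
- exact: data_bsupp.
- by apply: contM; [exact: cf|exact: cont_expw].
- by move=> y; rewrite mulr_ge0// expw_ge0.
- by rewrite mulr_gt0 ?expR_gt0// lt_neqAle eq_sym fx f0.
Qed.

Let u0_ge0 x : 0 <= u0 x. Proof. by have /andP[] := u01 x. Qed.
Let u1_ge0 x : 0 <= u1 x. Proof. by have /andP[h1 h2] := u01 x; exact: le_trans h2. Qed.

Let q := (1 - alpha)^-1 + r + 1.

Let q_ge1 : 1 <= q.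
Proof. by rewrite /q lerDr addr_ge0 ?(ltW r0)// invr_ge0 subr_ge0 ltW. Qed.

Let radius_growth t : 1 <= t -> phase alpha t + r + 1 <= q * t `^ (1 - alpha).
Proof.
move=> t1; have h : 1 <= t `^ (1 - alpha) by rewrite powR_ge1// subr_ge0 ltW.
rewrite /phase /q.
have i : 0 <= (1 - alpha)^-1 by rewrite invr_ge0 subr_ge0 ltW.
have r0' := r0; nra.
Qed.

(** The outcome of the blow-up argument, common to both weights: with [Phi] a primitive of
    t^(-g), a solution that exists beyond [t0] bounds the integral of
    t^(-g) over [1, t0], with the same [K] for all solutions and all sizes [eps] of
    the data. *)
Definition growth_bound (g K : R) : Prop :=
  forall (eps b t0 : R) (Phi : R -> R) u v a w c d, 0 < eps -> 1 < t0 -> t0 < b ->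
  wave_solution alpha mu p eps b u0 u1 u v a w c d ->
  (forall t : R, 0 < t -> is_derive t 1 Phi (t `^ (- g))) ->
  Phi t0 - Phi 1 <= K * eps `^ (1 - p).

Lemma plain_functional_bound : exists2 K : R, 0 < K &
  growth_bound ((p - 1) * (n%:R * (1 - alpha) + mu)) K.
Proof.
pose C := (32 * q) ^+ n; pose m := n%:R * (1 - alpha).
pose I1 := rV_int (fun x => u1 x * om 0 x).
have C0 : 0 < C by rewrite exprn_gt0// mulr_gt0//; have := q_ge1; lra.
have I10 : 0 < I1 by exact: data_pos.
have k0 : 0 < (p - 1) * C `^ (1 - p) by rewrite mulr_gt0 ?subr_gt0// powR_gt0.
exists (((p - 1) * C `^ (1 - p))^-1 * I1 `^ (1 - p)).
  by rewrite mulr_gt0 ?invr_gt0// powR_gt0.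
move=> eps b t0 Phi u v a w c d e0 t01 t0b ws dPhi.
have b1 : 1 < b by exact: lt_trans t0b.
pose V t := rV_int (fun x => v (t, x) * om 0 x).
pose G t := rV_int (fun x => `|v (t, x)| `^ p * om 0 x).
have V1 : V 1 = eps * I1.
  rewrite /V /I1 -rV_intZ; last exact: data_bsupp.
  by congr rV_int; apply/funext => x; rewrite (ws_u1 ws) mulrA.
have H := @damped_system_blowup R mu p t0 p1 t01 V G.
have : (p - 1) * C `^ (1 - p) * (Phi t0 - Phi 1) <= V 1 `^ (1 - p).
  apply: (H _ _ C m) => //.
  - move=> t /andP[t1 tt0]; have tb : t < b by exact: le_lt_trans t0b.
    by have [] := functional_cont a0 a1 mu0 p1 r0 b1 ws supp0 supp1 i0 0 tb.
  - move=> t /andP[t1 tt0]; have tb : t < b by exact: lt_trans t0b.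
    exact: (functional_G_ge0 a0 a1 mu0 p1 r0 b1 ws supp0 supp1 i0 0 tb).
  - move=> t /andP[t1 tt0]; have tb : t < b by exact: lt_trans t0b.
    apply: (is_derive_eq (functional_V a0 a1 mu0 p1 r0 b1 ws supp0 supp1 i0 0 t1 tb)).
    by rewrite expr0n mul0r mulr0 sub0r mulNr.
  - by rewrite V1 mulr_gt0.
  - move=> t /andP[t1 tt0] Vt; have tb : t < b by exact: lt_trans t0b.
    have tp : 0 < t by lra.
    have ph : 0 <= phase alpha t + r by rewrite addr_ge0 ?phase_ge0 ?(ltW r0)// ltW.
    apply: (functional_holder a0 a1 mu0 p1 r0 b1 ws supp0 supp1 (ltW t1) tb) => //.
      by rewrite mulr_gt0// powR_gt0.
    apply: (le_trans (ball_volume_le i0 ph)).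
    rewrite /C /m [_ * (1 - alpha)]mulrC powRrM powR_mulrn ?powR_ge0// -exprMn.
    rewrite lerXn2r ?nnegrE ?mulr_ge0 ?powR_ge0//; try by have := q_ge1; lra.
    by rewrite -mulrA ler_wpM2l// radius_growth// ltW.
  - by move=> t tp; rewrite [mu + m]addrC; exact: dPhi.
rewrite V1 powRM ?(ltW e0) ?(ltW I10)// => HH.
by rewrite -mulrA ler_pdivlMl// [I1 `^ _ * _]mulrC.
Qed.

Lemma exponential_functional_bound : exists2 K : R, 0 < K &
  growth_bound (((1 - alpha) * (n%:R - 1) + mu + alpha) * (p - 1) / 2) K.
Proof.
pose sq := Num.sqrt q.
have q0 : 0 < q by have := q_ge1; lra.
have sq0 : 0 < sq by rewrite sqrtr_gt0.
pose C := 32 * expR r * (64 * sq) ^+ n.-1; pose m := n.-1%:R * ((1 - alpha) / 2).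
pose I0 := rV_int (fun x => u0 x * om 1 x).
pose I1 := rV_int (fun x => u1 x * om 1 x).
have C0 : 0 < C by rewrite !mulr_gt0 ?expR_gt0 ?exprn_gt0// mulr_gt0.
have I00 : 0 < I0 by exact: data_pos.
have I10 : 0 < I1 by exact: data_pos.
have I01 : I0 <= I1.
  apply: rV_int_le; [exact: data_bsupp|exact: data_bsupp|] => x.
  by rewrite ler_wpM2r ?expw_ge0//; have /andP[] := u01 x.
pose l1 : R := 1 `^ ((alpha + mu) / 2) *
  expR (- phase alpha 1 - (4 * (1 - alpha))^-1 * 1 `^ (alpha - 1)).
have l10 : 0 < l1 by rewrite mulr_gt0 ?expR_gt0// powR_gt0.
pose D := (1 + (1 + mu) * (2 + mu)) `^ (- p) * C `^ (1 - p).
have D0 : 0 < D.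
  by rewrite mulr_gt0// powR_gt0// ltr_pwDl// mulr_ge0// addr_ge0.
have k0 : 0 < (p - 1) * D by rewrite mulr_gt0 ?subr_gt0.
exists (((p - 1) * D)^-1 * (l1 * I1) `^ (1 - p)).
  by rewrite (mulr_gt0 _ (powR_gt0 _ (mulr_gt0 l10 I10)))// invr_gt0.
move=> eps b t0 Phi u v a w c d e0 t01 t0b ws dPhi.
have b1 : 1 < b by exact: lt_trans t0b.
pose F t := rV_int (fun x => u (t, x) * om 1 x).
pose V t := rV_int (fun x => v (t, x) * om 1 x).
pose G t := rV_int (fun x => `|v (t, x)| `^ p * om 1 x).
have F1 : F 1 = eps * I0.
  rewrite /F /I0 -rV_intZ; last exact: data_bsupp.
  by congr rV_int; apply/funext => x; rewrite (ws_u0 ws) mulrA.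
have V1 : V 1 = eps * I1.
  rewrite /V /I1 -rV_intZ; last exact: data_bsupp.
  by congr rV_int; apply/funext => x; rewrite (ws_u1 ws) mulrA.
have H := @wave_system_blowup R alpha mu p t0 a0 a1 mu0 p1 t01 V G.
have : (p - 1) * D * (Phi t0 - Phi 1) <= (l1 * V 1) `^ (1 - p).
  apply: (H _ _ F _ _ _ _ _ C m) => //.
  - move=> t /andP[t1 tt0]; have tb : t < b by exact: le_lt_trans t0b.
    by have [] := functional_cont a0 a1 mu0 p1 r0 b1 ws supp0 supp1 i0 1 tb.
  - move=> t /andP[t1 tt0]; have tb : t < b by exact: lt_trans t0b.
    exact: (functional_G_ge0 a0 a1 mu0 p1 r0 b1 ws supp0 supp1 i0 1 tb).
  - move=> t /andP[t1 tt0]; have tb : t < b by exact: le_lt_trans t0b.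
    by have [] := functional_cont a0 a1 mu0 p1 r0 b1 ws supp0 supp1 i0 1 tb.
  - move=> t /andP[t1 tt0]; have tb : t < b by exact: lt_trans t0b.
    exact: (functional_F a0 a1 mu0 p1 r0 b1 ws supp0 supp1 i0 1 t1 tb).
  - move=> t /andP[t1 tt0]; have tb : t < b by exact: lt_trans t0b.
    apply: (is_derive_eq (functional_V a0 a1 mu0 p1 r0 b1 ws supp0 supp1 i0 1 t1 tb)).
    by rewrite expr1n mul1r.
  - by rewrite F1 mulr_gt0.
  - by rewrite F1 V1 ler_wpM2l// ltW.
  - move=> t /andP[t1 tt0] Vt; have tb : t < b by exact: lt_trans t0b.
    have tp : 0 < t by lra.
    have ph : 0 <= phase alpha t by rewrite phase_ge0// ltW.
    have phr : 0 < phase alpha t + r by rewrite ltr_wpDl.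
    apply: (functional_holder a0 a1 mu0 p1 r0 b1 ws supp0 supp1 (ltW t1) tb) => //.
      by rewrite (mulr_gt0 C0)// (mulr_gt0 (expR_gt0 _))// powR_gt0.
    apply: (le_trans (exp_ball_volume_le i0 phr)).
    rewrite /C expRD.
    have sle : Num.sqrt (phase alpha t + r) <= sq * t `^ ((1 - alpha) / 2).
      have -> : t `^ ((1 - alpha) / 2) = Num.sqrt (t `^ (1 - alpha)).
        by rewrite -powR12_sqrt ?powR_ge0// -powRrM.
      rewrite -sqrtrM ?(ltW q0)//; apply: ler_wsqrtr.
      by have := radius_growth (ltW t1); lra.
    have mE : t `^ m = (t `^ ((1 - alpha) / 2)) ^+ n.-1.
      by rewrite /m mulrC powRrM powR_mulrn// powR_ge0.
    have pw : (64 * Num.sqrt (phase alpha t + r)) ^+ n.-1 <=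
        (64 * sq) ^+ n.-1 * t `^ m.
      rewrite mE -exprMn lerXn2r ?nnegrE ?mulr_ge0 ?powR_ge0 ?sqrtr_ge0//.
      by rewrite -mulrA ler_wpM2l.
    rewrite [leRHS](_ : _ = 32 * (expR (phase alpha t) * expR r) *
      ((64 * sq) ^+ n.-1 * t `^ m)); last by ring.
    by rewrite ler_wpM2l// !mulr_ge0// expR_ge0.
  - move=> t tp; apply: (is_derive_eq (dPhi t tp)); congr (t `^ _).
    rewrite /m (_ : n.-1%:R = n%:R - 1 :> R); first by field.
    by rewrite -[in RHS](ltn_predK (ltn_ord i0)) -natr1 addrK.
rewrite V1 [l1 * _]mulrCA (powRM _ (ltW e0) (ltW (mulr_gt0 l10 I10))) => HH.
by rewrite -mulrA ler_pdivlMl// [(l1 * I1) `^ _ * _]mulrC.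
Qed.

End BlowUp.
(** * Bounds on the existence time *)

Section ExistenceTime.
Context {R : realType} {n : nat}.
Variables (alpha mu p : R) (u0 u1 : 'rV[R]_n -> R).

Lemma ereal_le_of_lt_bound (T : \bar R) (X : R) : (1 < T)%E ->
  (forall t : R, 1 < t -> (t%:E < T)%E -> t <= X) -> (T <= X%:E)%E.
Proof.
move=> T1 H; rewrite leNgt; apply/negP => XT.
have mT : ((Num.max 1 X)%:E < T)%E by rewrite /Num.max; case: ifP.
have m1 : 1 <= Num.max 1 X by rewrite le_max lexx.
have mX : X <= Num.max 1 X by rewrite le_max lexx orbT.
have [t mt tT] : exists2 t : R, Num.max 1 X < t & (t%:E < T)%E.
  case: T T1 H XT mT => [s| |] // _ _ _.
    by rewrite lte_fin => ms; exists ((Num.max 1 X + s) / 2); rewrite ?lte_fin; lra.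
  by move=> _; exists (Num.max 1 X + 1); rewrite ?ltry//; lra.
by have := H t (le_lt_trans m1 mt) tT; lra.
Qed.

Lemma growth_bound_time (g K eps : R) (T : \bar R) (u : R * 'rV[R]_n -> R)
    (Phi : R -> R) (t : R) :
  growth_bound alpha mu p u0 u1 g K -> 0 < eps -> (1 < T)%E ->
  classical_solution alpha mu p eps u0 u1 T u ->
  (forall t : R, 0 < t -> is_derive t 1 Phi (t `^ (- g))) ->
  1 < t -> (t%:E < T)%E -> Phi t - Phi 1 <= K * eps `^ (1 - p).
Proof.
move=> H e0 T1 sol dPhi t1 tT.
have [b tb bT] : exists2 b : R, t < b & (b%:E <= T)%E.
  case: T T1 tT {sol} => [s| |] // _.
    by rewrite lte_fin => ts; exists s.
  by move=> _; exists (t + 1); rewrite ?leey//; lra.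
exact: H e0 t1 tb (classical_wave_solution T1 bT sol) dPhi.
Qed.

Lemma existence_time_subcritical (g K eps : R) (T : \bar R) (u : R * 'rV[R]_n -> R) :
  growth_bound alpha mu p u0 u1 g K -> 0 < K -> g < 1 -> 0 < eps -> (1 < T)%E ->
  classical_solution alpha mu p eps u0 u1 T u ->
  (T <= ((1 + (1 - g) * (K * eps `^ (1 - p))) `^ ((1 - g)^-1))%:E)%E.
Proof.
move=> H K0 g1 e0 T1 sol; apply: ereal_le_of_lt_bound => // t t1 tT.
have := growth_bound_time H e0 T1 sol (fun t tp => drv_phase g1 tp) t1 tT.
have g0 : 0 < 1 - g by rewrite subr_gt0.
rewrite phase1 subr0 ler_pdivrMr// => h.
have tp : 0 < t by lra.
have -> : t = (t `^ (1 - g)) `^ ((1 - g)^-1).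
  by rewrite -powRrM mulfV ?gt_eqF// powRr1// ltW.
apply: ge0_ler_powR; rewrite ?invr_ge0 ?(ltW g0)// ?nnegrE ?powR_ge0//.
  by rewrite addr_ge0// mulr_ge0 ?(ltW g0)// mulr_ge0 ?(ltW K0)// powR_ge0.
lra.
Qed.

Lemma existence_time_critical (K eps : R) (T : \bar R) (u : R * 'rV[R]_n -> R) :
  growth_bound alpha mu p u0 u1 1 K -> 0 < eps -> (1 < T)%E ->
  classical_solution alpha mu p eps u0 u1 T u ->
  (T <= (expR (K * eps `^ (1 - p)))%:E)%E.
Proof.
move=> H e0 T1 sol; apply: ereal_le_of_lt_bound => // t t1 tT.
have tp : 0 < t by lra.
have dln (s : R) : 0 < s -> is_derive s 1 (@ln R) (s `^ (- 1)).
  move=> s0; rewrite powR_inv1 ?(ltW s0)//; exact: is_derive1_ln.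
have := growth_bound_time H e0 T1 sol dln t1 tT.
rewrite ln1 subr0 => h.
by rewrite -[leLHS](@lnK R t) ?posrE// ler_expR.
Qed.

Lemma subcritical_power_bound (g K eps : R) : 1 < p -> 0 < K -> g < 1 ->
  0 < eps <= 1 ->
  (1 + (1 - g) * (K * eps `^ (1 - p))) `^ ((1 - g)^-1) <=
  (1 + (1 - g) * K) `^ ((1 - g)^-1) * eps `^ (- (p - 1) / (1 - g)).
Proof.
move=> p1 K0 g1 /andP[e0 e1]; have g0 : 0 < 1 - g by rewrite subr_gt0.
have h1 : 1 <= eps `^ (1 - p).
  by rewrite -[leLHS](powRr0 eps) ger_powR ?e0//; lra.
have h0 : 0 <= (1 - g) * K by rewrite mulr_ge0 ?ltW.
have -> : - (p - 1) / (1 - g) = (1 - p) * (1 - g)^-1 by rewrite opprB.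
rewrite powRrM -powRM ?powR_ge0//; last by rewrite addr_ge0.
apply: ge0_ler_powR; rewrite ?invr_ge0 ?(ltW g0)// ?nnegrE.
- by rewrite addr_ge0// mulr_ge0 ?(ltW g0)// mulr_ge0 ?(ltW K0)// powR_ge0.
- by rewrite mulr_ge0 ?powR_ge0// addr_ge0.
nra.
Qed.

End ExistenceTime.

Theorem theorem2p1 (R : realType) (n : nat) (alpha mu p r : R)
    (u0 u1 : 'rV[R]_n -> R)
    (hn : (2 <= n)%N) (halpha : 0 <= alpha < 1) (hmu : 0 <= mu)
    (hp : 1 < p <= pG' n alpha mu \/ 1 < p < p0 n alpha mu)
    (hu0C2 : Ck_space 2 u0) (hu1C1 : Ck_space 1 u1)
    (hu0nt : exists x, u0 x != 0) (hu1nt : exists x, u1 x != 0)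
    (hu : forall x, 0 <= u0 x <= u1 x)
    (hr : 0 < r)
    (hsupp0 : supp u0 `<=` [set x | enorm x <= r])
    (hsupp1 : supp u1 `<=` [set x | enorm x <= r]) :
  (forall (eps : R) (T : \bar R) (u : spacetime -> R),
      0 < eps -> (1 < T)%E ->
      classical_solution alpha mu p eps u0 u1 T u ->
      (T < +oo)%E) /\
  (exists eps0 C : R,
     [/\ 0 < eps0, 0 < C &
      forall eps : R, 0 < eps <= eps0 ->
      [/\ p < pG' n alpha mu ->
            (lifespan alpha mu p eps u0 u1 <=
             (C * eps `^ (- (p - 1) /
                (1 - ((1 - alpha) * (n%:R - 1) + mu + alpha)
                     * (p - 1) / 2)))%:E)%E,
          p = pG' n alpha mu ->
            (lifespan alpha mu p eps u0 u1 <=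
             (expR (C * eps `^ (- (p - 1))))%:E)%E &
          p < p0 n alpha mu ->
            (lifespan alpha mu p eps u0 u1 <=
             (C * eps `^ (- (p - 1) /
                (1 - (p - 1) * (n%:R * (1 - alpha) + mu))))%:E)%E]]).
Proof.
have [a0 a1] := andP halpha.
have n0 : (0 < n)%N by exact: leq_trans hn.
pose i0 : 'I_n := Ordinal n0.
have p1 : 1 < p by case: hp => /andP[].
have supp_sqn (f : 'rV[R]_n -> R) : supp f `<=` [set x | enorm x <= r] ->
    forall x, r ^+ 2 < sqn x -> f x = 0.
  move=> hf x rx; apply/eqP; rewrite -[_ == _]negbK; apply/negP => fx.
  have : enorm x <= r by apply: hf; exact: subset_closure.
  rewrite -ler_sqr ?nnegrE ?sqrtr_ge0 ?(ltW hr)// sqr_sqrtr ?sqn_ge0//.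
  by rewrite leNgt rx.
have s0 := supp_sqn _ hsupp0; have s1 := supp_sqn _ hsupp1.
have cu0 : continuous u0 by have [c _] := hu0C2; exact/continuous_subspace_setT.
have cu1 : continuous u1 by have [c _] := hu1C1; exact/continuous_subspace_setT.
have [K1 K10 B1] := plain_functional_bound i0 a0 a1 hmu p1 hr s0 s1 cu1 hu1nt hu.
have [K2 K20 B2] := exponential_functional_bound i0 a0 a1 hmu p1 hr s0 s1
  cu0 cu1 hu0nt hu1nt hu.
have n2 : 2 <= n%:R :> R by rewrite ler_nat.
set g1 := (p - 1) * (n%:R * (1 - alpha) + mu) in B1 *.
set X := (1 - alpha) * (n%:R - 1) + mu + alpha in B2 *.
set g2 := X * (p - 1) / 2 in B2 *.
have X0 : 0 < X by rewrite /X; nra.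
have Y0 : 0 < n%:R * (1 - alpha) + mu.
  by rewrite ltr_wpDr// mulr_gt0 ?subr_gt0//; lra.
have sub2 : p < pG' n alpha mu -> g2 < 1.
  rewrite /pG' -/X -ltrBlDl ltr_pdivlMr// /g2 => h.
  by rewrite ltr_pdivrMr// mul1r mulrC.
have crit : p = pG' n alpha mu -> g2 = 1.
  move=> pE; have -> : g2 = X * (pG' n alpha mu - 1) / 2 by rewrite /g2 -pE.
  by rewrite /pG' -/X; field; rewrite gt_eqF.
have sub1 : p < p0 n alpha mu -> g1 < 1.
  by rewrite /p0 -ltrBlDl ltr_pdivlMr.
split.
  move=> eps T u e0 T1 sol.
  case: hp => /andP[_].
    rewrite le_eqVlt => /predU1P[/crit E|/sub2 h].
      rewrite E in B2.
      exact: le_lt_trans (existence_time_critical B2 e0 T1 sol) (ltry _).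
    exact: le_lt_trans (existence_time_subcritical B2 K20 h e0 T1 sol) (ltry _).
  move=> /sub1 h.
  exact: le_lt_trans (existence_time_subcritical B1 K10 h e0 T1 sol) (ltry _).
pose C1 := (1 + (1 - g1) * K1) `^ ((1 - g1)^-1).
pose C2 := (1 + (1 - g2) * K2) `^ ((1 - g2)^-1).
have C10 : 0 <= C1 by exact: powR_ge0.
have C20 : 0 <= C2 by exact: powR_ge0.
exists 1, (C1 + C2 + K2); split=> //; first by rewrite ltr_wpDl// addr_ge0.
move=> eps eI; have /andP[e0 e1] := eI.
split=> h; apply: ge_ereal_sup => T [T1 [u sol]].
- have g := sub2 h.
  apply: (le_trans (existence_time_subcritical B2 K20 g e0 T1 sol)).
  rewrite lee_fin; apply: (le_trans (subcritical_power_bound p1 K20 g eI)).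
  by rewrite ler_wpM2r ?powR_ge0// -/C2; lra.
- rewrite (crit h) in B2.
  apply: (le_trans (existence_time_critical B2 e0 T1 sol)).
  rewrite lee_fin ler_expR opprB ler_wpM2r ?powR_ge0//; lra.
- have g := sub1 h.
  apply: (le_trans (existence_time_subcritical B1 K10 g e0 T1 sol)).
  rewrite lee_fin; apply: (le_trans (subcritical_power_bound p1 K10 g eI)).
  by rewrite ler_wpM2r ?powR_ge0// -/C1; lra.
Qed.
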